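(* Let $(\tilde{\mathcal M},\tilde{\mathbf c},\tilde N,\tilde K)$ be an almost Robinson geometry, and let $\tilde\sigma\in\Gamma(\tilde{\mathcal E}[1])$ be an almost Lorentzian scale, so that $\tilde g=\tilde\sigma^{-2}\tilde{\boldsymbol g}\in\tilde{\mathbf c}$ is a smooth metric off the zero set of $\tilde\sigma$. Then (1) $\tilde\sigma$ is an almost weakly half-Einstein scale if and only if $\tilde g$ is a weakly half-Einstein metric (off the zero set of $\tilde\sigma$); (2) $\tilde\sigma$ is an almost half-Einstein scale if and only if $\tilde g$ is a half-Einstein metric (off the zero set of $\tilde\sigma$).
   Context: $(\tilde{\mathcal M},\tilde{\mathbf c})$ is an oriented, time-oriented Lorentzian conformal manifold of dimension $n+2=2m+2$. $\tilde{\mathcal E}[w]$ are the conformal density bundles; $\tilde{\boldsymbol g}_{ab}$ is the conformal metric (weight $2$), so that nowhere vanishing $\tilde\sigma$ of weight $1$ correspond (up to sign) to metrics $\tilde g=\tilde\sigma^{-2}\tilde{\boldsymbol g}\in\tilde{\mathbf c}$; Levi-Civita connections $\tilde\nabla$ of metrics in $\tilde{\mathbf c}$ extend to densities and preserve $\tilde{\boldsymbol g}$. Indices are raised and lowered with $\tilde{\boldsymbol g}$; $(\cdot)_\circ$ is the trace-free part. The Schouten tensor is $\tilde{\mathsf P}_{ab}=\frac1n\big(\widetilde{\mathsf{Ric}}_{ab}-\frac1{2(n+1)}\widetilde{\mathsf{Sc}}\,\tilde{\boldsymbol g}_{ab}\big)$. An almost Robinson geometry $(\tilde{\mathcal M},\tilde{\mathbf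 c},\tilde N,\tilde K)$ is such a conformal manifold with a totally null complex $(m+1)$-plane distribution $\tilde N\subset{}^{\mathbb C}T\tilde{\mathcal M}$ and a real null line distribution $\tilde K$ with ${}^{\mathbb C}\tilde K=\tilde N\cap\overline{\tilde N}$. A metric $\tilde g\in\tilde{\mathbf c}$ is weakly half-Einstein if $\widetilde{\mathsf{Ric}}_{ab}\tilde v^a\tilde v^b=0$ for all $\tilde v\in\Gamma(\tilde N)$, and half-Einstein if moreover its Ricci scalar is constant. An almost Lorentzian scale is $\tilde\sigma\in\Gamma(\tilde{\mathcal E}[1])$ with $\tilde\nabla\tilde\sigma\neq0$ on its zero set, $\tilde\nabla$ being the Levi-Civita connection of some (hence any) metric in $\tilde{\mathbf c}$. An almost Lorentzian scale $\tilde\sigma$ is an almost weakly half-Einstein scale if $$\big(\tilde\nabla_a\tilde\nabla_b\tilde\sigma+\tilde{\mathsf P}_{ab}\tilde\sigma\big)_\circ=\tfrac1n\tilde\Phi_{ab}\tilde\sigma$$ for some trace-free symmetric tensor $\tilde\Phi_{ab}$ with $\tilde\Phi_{ab}\tilde v^a\tilde v^b=0$ for all $\tilde v\in\Gamma(\tilde N)$; it is an almost half-Einstein scale if moreover $\tilde\Phi_a{}^b\tilde\nabla_b\tilde\sigma-\frac1n\tilde\sigma\tilde\nabla_b\tilde\Phi_a{}^b=0$.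
   Formalization: The tensor Φ and the equations defining almost (weakly) half-Einstein scales are required only off the zero set of σ (with Φ on all of M the ''if'' parts fail), and ''constant Ricci scalar'' means constant off the zero set along each connected component of the manifold. *)

(* Defs.v *)
From HB Require Import structures.
From mathcomp Require Import all_boot all_order all_algebra.
From mathcomp Require Import complex.
From mathcomp Require Import all_classical all_reals all_analysis.

Set Implicit Arguments.
Unset Strict Implicit.
Unset Printing Implicit Defensive.

Import Order.TTheory GRing.Theory Num.Theory.
Import numFieldNormedType.Exports.

Local Open Scope classical_set_scope.
Local Open Scope ring_scope.

(* Classical tensor calculus: a tensor field is the family of its component
   functions, indexed by the charts of an atlas and by the points of the
   manifold, subject to the usual transformation law on overlaps.  Component
   families are total functions; only their values at points of the domain of
   the chart are meaningful. *)

Section Smooth.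
Context {R : realType} {d : nat}.

Fixpoint Ck (k : nat) (V : set 'rV[R]_d) (f : 'rV[R]_d -> R) : Prop :=
  if k is k'.+1 then
    (forall x, V x -> differentiable f x) /\
    (forall a : 'I_d, Ck k' V (fun x => 'D_('e_a) f x))
  else forall x, V x -> {for x, continuous f}.

(* C^oo on the open set V. *)
Definition Csmooth (V : set 'rV[R]_d) (f : 'rV[R]_d -> R) : Prop :=
  forall k, Ck k V f.

End Smooth.

(* [param i] is the inverse of the coordinate map [coord i] on its image; the
   orientation is that of the (oriented) atlas.  The atlas need not be
   maximal. *)
Record oriented_manifold (R : realType) (d : nat) := OrientedManifold {
  points :> topologicalType;
  chart : Type;
  dom : chart -> set points;
  coord : chart -> points -> 'rV[R]_d;
  param : chart -> 'rV[R]_d -> points;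
  points_hausdorff : hausdorff_space points;
  points_second_countable : @second_countable points;
  dom_cover : forall p, exists i, dom i p;
  dom_open : forall i, open (dom i);
  coord_open : forall i, open (coord i @` dom i);
  coordK : forall i p, dom i p -> param i (coord i p) = p;
  coord_continuous : forall i p, dom i p -> {for p, continuous (coord i)};
  param_continuous : forall i x, (coord i @` dom i) x ->
    {for x, continuous (param i)};
  transition_smooth : forall i j a,
    Csmooth (coord i @` (dom i `&` dom j))
            (fun x => coord j (param i x) ord0 a);
  transition_oriented : forall i j p, dom i p -> dom j p ->
    0 < \det (jacobian (coord j \o param i) (coord i p))
}.

Section Tensors.
Context {R : realType} {d : nat} {M : oriented_manifold R d}.
Local Notation C := R[i].

Definition realC : R -> C := real_complex R.

(* Entry (a, b) is the partial derivative of y^b by x^a, where x and y are the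
   coordinates of the charts i and j. *)
Definition jac (i j : chart M) (p : M) : 'M[R]_d :=
  jacobian (coord j \o param i) (coord i p).

(* Coordinate partial derivative, in the chart i and the direction a. *)
Definition pd (i : chart M) (a : 'I_d) (f : M -> R) (p : M) : R :=
  'D_('e_a) (f \o param i) (coord i p).

Definition smooth_in (i : chart M) (W : set M) (f : M -> R) : Prop :=
  Csmooth (coord i @` (dom i `&` W)) (f \o param i).

Definition smooth_inC (i : chart M) (W : set M) (f : M -> C) : Prop :=
  smooth_in i W (fun q => complex.Re (f q)) /\
  smooth_in i W (fun q => complex.Im (f q)).

Definition smooth_fun (W : set M) (f : M -> R) : Prop :=
  forall i, smooth_in i W f.

Definition vfield := chart M -> M -> 'rV[R]_d.
Definition vfieldC := chart M -> M -> 'rV[C]_d.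
Definition tensor2 := chart M -> M -> 'M[R]_d.

Definition is_vfield (W : set M) (v : vfield) : Prop :=
  (forall i a, smooth_in i W (fun q => v i q ord0 a)) /\
  (forall i j p, W p -> dom i p -> dom j p -> v j p = v i p *m jac i j p).

Definition is_vfieldC (W : set M) (v : vfieldC) : Prop :=
  (forall i a, smooth_inC i W (fun q => v i q ord0 a)) /\
  (forall i j p, W p -> dom i p -> dom j p ->
     v j p = v i p *m map_mx realC (jac i j p)).

Definition is_tensor2 (W : set M) (T : tensor2) : Prop :=
  (forall i a b, smooth_in i W (fun q => T i q a b)) /\
  (forall i j p, W p -> dom i p -> dom j p ->
     T i p = jac i j p *m T j p *m (jac i j p)^T).

Definition symmetric2 (W : set M) (T : tensor2) : Prop :=
  forall i p, W p -> dom i p -> (T i p)^T = T i p.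

Definition minkowski : 'M[R]_d :=
  diag_mx (\row_k (if val k == 0%N then -1 else 1)).

Definition lorentzian_metric (g : tensor2) : Prop :=
  [/\ is_tensor2 setT g,
      symmetric2 setT g &
      forall i p, dom i p ->
        exists2 B, B \in unitmx & B *m g i p *m B^T = minkowski].

Definition rescaling (omega : M -> R) (g g' : tensor2) : Prop :=
  [/\ smooth_fun setT omega,
      forall p, 0 < omega p &
      forall i p, dom i p -> g' i p = omega p ^+ 2 *: g i p].

(* A distribution of rank r is given by a matrix whose row space is the fibre,
   in each chart and at each point; it is spanned locally by smooth sections. *)
Definition distribution (r : nat) (D : chart M -> M -> 'M[R]_(r, d)) : Prop :=
  [/\ forall i p, dom i p -> row_free (D i p),
      forall i j p, dom i p -> dom j p -> (D j p :=: D i p *m jac i j p)%MS &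
      forall i p, dom i p -> exists W : set M, exists B : M -> 'M[R]_(r, d),
        [/\ open W, W p, W `<=` dom i,
            forall k a, smooth_in i W (fun q => B q k a) &
            forall q, W q -> (B q :=: D i q)%MS]].

Definition distributionC (r : nat) (D : chart M -> M -> 'M[C]_(r, d)) : Prop :=
  [/\ forall i p, dom i p -> row_free (D i p),
      forall i j p, dom i p -> dom j p ->
        (D j p :=: D i p *m map_mx realC (jac i j p))%MS &
      forall i p, dom i p -> exists W : set M, exists B : M -> 'M[C]_(r, d),
        [/\ open W, W p, W `<=` dom i,
            forall k a, smooth_inC i W (fun q => B q k a) &
            forall q, W q -> (B q :=: D i q)%MS]].

Definition section_of (r : nat) (D : chart M -> M -> 'M[C]_(r, d))
    (W : set M) (v : vfieldC) : Prop :=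
  is_vfieldC W v /\ forall i p, W p -> dom i p -> (v i p <= D i p)%MS.

(* Complex bilinear extension of a real bilinear form. *)
Definition evalC (T : 'M[R]_d) (v w : 'rV[C]_d) : C :=
  (v *m map_mx realC T *m w^T) ord0 ord0.

Definition trace_wrt (g T : 'M[R]_d) : R :=
  \sum_a \sum_b invmx g a b * T a b.

Definition tracefree_part (g T : 'M[R]_d) : 'M[R]_d :=
  T - (d%:R^-1 * trace_wrt g T) *: g.

(* Levi-Civita connection of g: nabla_a d_b = Gamma_ab^c d_c, with the
   arguments in the order a b c. *)
Definition christoffel (g : tensor2) (i : chart M) (a b c : 'I_d) (p : M) : R :=
  2^-1 * \sum_e invmx (g i p) c e *
    (pd i a (fun q => g i q b e) p + pd i b (fun q => g i q a e) p
     - pd i e (fun q => g i q a b) p).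

(* R_ab^c_e, where (nabla_a nabla_b - nabla_b nabla_a) v^c = R_ab^c_e v^e. *)
Definition riemann (g : tensor2) (i : chart M) (a b c e : 'I_d) (p : M) : R :=
  pd i a (christoffel g i b e c) p - pd i b (christoffel g i a e c) p
  + \sum_f (christoffel g i a f c p * christoffel g i b e f p
            - christoffel g i b f c p * christoffel g i a e f p).

Definition ricci (g : tensor2) : tensor2 :=
  fun i p => \matrix_(a, b) \sum_c riemann g i c a c b p.

Definition ricci_scalar (g : tensor2) (i : chart M) (p : M) : R :=
  trace_wrt (g i p) (ricci g i p).

(* nabla_a nabla_b f *)
Definition hessian (g : tensor2) (f : M -> R) : tensor2 :=
  fun i p => \matrix_(a, b)
    (pd i a (pd i b f) p - \sum_c christoffel g i a b c p * pd i c f p).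

(* nabla_c T_ab *)
Definition cov_deriv (g T : tensor2) (i : chart M) (c a b : 'I_d) (p : M) : R :=
  pd i c (fun q => T i q a b) p
  - \sum_e christoffel g i c a e p * T i p e b
  - \sum_e christoffel g i c b e p * T i p a e.

(* nabla_b T_a^b *)
Definition divergence (g T : tensor2) (i : chart M) (a : 'I_d) (p : M) : R :=
  \sum_b \sum_c invmx (g i p) b c * cov_deriv g T i c a b p.

End Tensors.
Arguments vfield {R d} M.
Arguments vfieldC {R d} M.
Arguments tensor2 {R d} M.

Record conformal_manifold (R : realType) (d : nat) := ConformalManifold {
  cmfd :> oriented_manifold R d;
  cclass : set (tensor2 cmfd);
  cclassP : exists2 g0, lorentzian_metric g0 &
    cclass = [set g | lorentzian_metric g /\
                      exists omega, rescaling omega g0 g];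
  time_dir : vfield cmfd;
  time_dir_smooth : is_vfield setT time_dir;
  time_dir_timelike : forall g i p, cclass g -> dom i p ->
    (time_dir i p *m g i p *m (time_dir i p)^T) ord0 ord0 < 0
}.

Section Conformal.
Context {R : realType} {d : nat} {M : conformal_manifold R d}.

(* A section of E[w] is identified with its expressions in the
   trivialisations of the density bundles given by the metrics of the class,
   equivalently with a function on the ray bundle of metrics that is
   homogeneous of degree w.  The conformal metric is then g |-> g (weight 2),
   and the Levi-Civita connection of g acts on densities as it acts on
   functions, in the trivialisation given by g. *)
Definition density_fam := tensor2 M -> M -> R.

Definition density (w : R) (s : density_fam) : Prop :=
  (forall g, cclass g -> smooth_fun setT (s g)) /\
  (forall g g' omega, cclass g -> cclass g' -> rescaling omega g g' ->
     forall p, s g' p = (omega p) `^ w * s g p).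

Definition zero_set (s : density_fam) : set M :=
  [set p | exists2 g, cclass g & s g p = 0].

(* gt = s^-2 times the conformal metric, off the zero set of s. *)
Definition metric_of_scale (s : density_fam) (gt : tensor2 M) : Prop :=
  forall g i p, cclass g -> ~ zero_set s p -> dom i p ->
    gt i p = (s g p) ^- 2 *: g i p.

Definition almost_lorentzian_scale (s : density_fam) : Prop :=
  density 1 s /\
  exists2 g, cclass g &
    forall i p, zero_set s p -> dom i p -> exists a, pd i a (s g) p != 0.

End Conformal.
Arguments density_fam {R d} M.

Section HalfEinstein.
Context {R : realType} {m : nat}.
Local Notation n := (m.*2)%N.
Context {M : conformal_manifold R n.+2}.
Local Notation C := R[i].

Definition almost_robinson (N : chart M -> M -> 'M[C]_(m.+1, n.+2))
    (K : chart M -> M -> 'M[R]_(1, n.+2)) : Prop :=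
  [/\ distributionC N,
      forall g i p, cclass g -> dom i p ->
        N i p *m map_mx realC (g i p) *m (N i p)^T = 0,
      distribution K,
      forall g i p, cclass g -> dom i p ->
        K i p *m g i p *m (K i p)^T = 0 &
      forall i p, dom i p ->
        (map_mx realC (K i p) :=: N i p :&: map_mx conjc (N i p))%MS].

Definition schouten (g : tensor2 M) : tensor2 M := fun i p =>
  n%:R^-1 *: (ricci g i p - ((2 * n.+1)%:R^-1 * ricci_scalar g i p) *: g i p).

Variable N : chart M -> M -> 'M[C]_(m.+1, n.+2).

Definition weakly_half_einstein (W : set M) (g : tensor2 M) : Prop :=
  forall v, section_of N W v ->
  forall i p, W p -> dom i p -> evalC (ricci g i p) (v i p) (v i p) = 0.

(* The Ricci scalar is to be constant on W along each connected component of
   M; if M is connected, it is constant on W, even if W is not connected. *)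
Definition half_einstein (W : set M) (g : tensor2 M) : Prop :=
  weakly_half_einstein W g /\
  forall i j p q, W p -> W q -> dom i p -> dom j q ->
    connected_component [set: M] p q ->
    ricci_scalar g i p = ricci_scalar g j q.

(* Phi is, up to a factor, the trace-free Ricci tensor of the metric of the
   scale s; in general it blows up at the zero set of s, so that it is a
   tensor field on the complement of this set. *)
Definition half_einstein_tensor (s : density_fam M) (Phi : tensor2 M) : Prop :=
  let W := ~` zero_set s in
  [/\ is_tensor2 W Phi,
      symmetric2 W Phi,
      forall g i p, cclass g -> W p -> dom i p ->
        trace_wrt (g i p) (Phi i p) = 0,
      forall v, section_of N W v ->
        forall i p, W p -> dom i p -> evalC (Phi i p) (v i p) (v i p) = 0 &
      forall g i p, cclass g -> W p -> dom i p ->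
        tracefree_part (g i p) (hessian g (s g) i p + s g p *: schouten g i p)
        = (n%:R^-1 * s g p) *: Phi i p].

Definition almost_weakly_half_einstein_scale (s : density_fam M) : Prop :=
  almost_lorentzian_scale s /\ exists Phi, half_einstein_tensor s Phi.

Definition almost_half_einstein_scale (s : density_fam M) : Prop :=
  almost_lorentzian_scale s /\
  exists2 Phi, half_einstein_tensor s Phi &
    forall g i p a, cclass g -> ~ zero_set s p -> dom i p ->
      \sum_b \sum_c invmx (g i p) b c * Phi i p a c * pd i b (s g) p
      - n%:R^-1 * s g p * divergence g Phi i a p = 0.

End HalfEinstein.

(* Main.v *)
From HB Require Import structures.
Require Import Defs.
From mathcomp Require Import all_boot all_order all_algebra.
From mathcomp Require Import complex.
From mathcomp Require Import all_classical all_reals all_analysis.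
From mathcomp Require Import ring lra.

Set Implicit Arguments.
Unset Strict Implicit.
Unset Printing Implicit Defensive.

Import Order.TTheory GRing.Theory Num.Theory.
Import numFieldNormedType.Exports.

Local Open Scope classical_set_scope.
Local Open Scope ring_scope.

(** Let [N = n + 2] be the dimension, [g] a metric of the conformal class, [u]
    the expression of the scale in the trivialisation given by [g], and
    [gt = u^-2 g].  Two formulas carry the proof.  The first is the conformal
    transformation of the Ricci tensor ([ric_conf]),
      Ric(gt) = Ric(g) + (n / u) Hess u + k g      for some function k.
    Taking trace-free parts, n (Hess u + u P)_o = u Ric(gt)_o
    ([tracefree_scale_eq]): the tensor Phi of an almost weakly half-Einstein
    scale can only be the trace-free Ricci tensor of [gt].  Since the
    distribution is totally null, Phi and Ric(gt) agree on it, and (1) follows.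

    The second formula is the conformal transformation of the divergence of a
    symmetric trace-free tensor ([div_conf]): the extra equation of an almost
    half-Einstein scale says, up to the factor -1/(n u), that Phi is
    divergence-free for [gt].  By the contracted Bianchi identity the
    divergence of Ric(gt)_o is n/(2N) times the gradient of the Ricci scalar
    of [gt] ([contracted_bianchi], [divergence_condition]), so that the extra
    equation says that this scalar is locally constant off the zero set.

    The zero set may separate the manifold, so a global argument is still
    needed for (2).  The trace of the first formula is
      Sc(gt) = u^2 Sc(g) + 2 (N - 1) u Lap u - N (N - 1) |du|^2,
    whose right-hand side is smooth across the zero set ([scal_ext]).  The
    complement of the zero set is dense, because du <> 0 on the zero set;
    hence the gradient of the right-hand side vanishes everywhere, and Sc(gt)
    is constant along each connected component of the manifold
    ([scalar_constant]).

    The computations take place in a chart.  The connection is the family of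
    matrices [A a] with entries [(A a) b c = Gamma_ab^c], acting on row vectors
    from the right; its curvature is the matrix-valued 2-form [curv A], and the
    second Bianchi identity and the symmetries of the curvature become
    identities between products of matrices.  The tensors Phi and Ric(gt) must
    also be compared in different charts: the connection matrices of two charts
    are related by a gauge transformation whose matrix is the Jacobian of the
    change of coordinates ([chr_pullback], [gauge_curv]), which gives the
    transformation law of the Ricci tensor ([ric_transform]). *)

(** * Functions of class C^oo on an open set *)

Lemma near_differentiable (R : realType) (U W : normedModType R)
    (f g : U -> W) (x : U) :
  (\near x, f x = g x) -> differentiable f x -> differentiable g x.
Proof.
move=> fg df; pose h := g - f.
have h0 : \near x, h x = 0 by near=> y; rewrite /h !fctE (near fg y)// subrr.
have dh : differentiable h x.
  have hE : h \o shift x = cst (h x) + (\0 : {linear U -> W}) +o_ (0 : U) id.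
    apply/eqaddoP => _/posnumP[e].
    move: (h0); rewrite (near_shift 0); apply: filterS => y /= hy.
    rewrite subr0 in hy.
    by rewrite !fctE /= hy (nbhs_singleton h0) addr0 subr0 normr0 mulr_ge0.
  have hd : 'd h x = (\0 : {linear U -> W}) :> (U -> W).
    by apply: diff_unique => //; exact: cst_continuous.
  by apply/diff_locallyP; rewrite hd; split=> //; exact: cst_continuous.
have -> : g = f + h by rewrite /h addrC subrK.
exact: differentiableD.
Unshelve. all: by end_near. Qed.

Lemma near_continuous (T U : topologicalType) (f g : T -> U) (x : T) :
  (\near x, f x = g x) -> {for x, continuous f} -> {for x, continuous g}.
Proof.
move=> fg cf; suff: g @ x --> g x by [].
by rewrite -(nbhs_singleton fg); apply: cvg_trans cf; exact: near_eq_cvg.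
Qed.

Section SmoothFunctions.
Context {R : realType} {d : nat}.
Implicit Types (V : set 'rV[R]_d) (f g : 'rV[R]_d -> R) (x : 'rV[R]_d).

Lemma open_near_eq V f g x : open V -> (forall y, V y -> f y = g y) ->
  V x -> \near x, f x = g x.
Proof.
move=> oV fg Vx; apply: filterS (open_nbhs_nbhs (conj oV Vx)) => y; exact: fg.
Qed.

(** Openness matters: a derivative at a point depends on the values nearby. *)
Lemma Ck_ext k V f g : open V -> (forall y, V y -> f y = g y) ->
  Ck k V f -> Ck k V g.
Proof.
move=> oV; elim: k f g => [|k IH] f g fg /=.
  move=> cf x Vx; apply: near_continuous (cf x Vx).
  exact: open_near_eq fg Vx.
move=> [df Df]; split=> [x Vx|a].
  by apply: near_differentiable (df x Vx); exact: open_near_eq fg Vx.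
apply: IH (Df a) => x Vx; apply: near_eq_derive; exact: open_near_eq fg Vx.
Qed.

Lemma Ck_pred k V f : Ck k.+1 V f -> Ck k V f.
Proof.
elim: k f => [|k IH] f [df Df] /=.
  by move=> x Vx; apply: differentiable_continuous; exact: df.
by split=> // a; apply: IH; exact: Df.
Qed.

Lemma Ck_sub k V V' f : V' `<=` V -> Ck k V f -> Ck k V' f.
Proof.
move=> V'V; elim: k f => [|k IH] f /=; first by move=> cf x /V'V; exact: cf.
by move=> [df Df]; split=> [x /V'V|a]; [exact: df|exact: IH].
Qed.

Lemma Ck_cst k V (c : R) : open V -> Ck k V (cst c).
Proof.
move=> oV; elim: k c => [|k IH] c /=; first by move=> x _; exact: cst_continuous.
split=> [x _|a]; first exact: differentiable_cst.
by apply: Ck_ext (IH 0) => // x _; rewrite derive_cst.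
Qed.

Lemma CkD k V f g : open V -> Ck k V f -> Ck k V g -> Ck k V (f + g).
Proof.
move=> oV; elim: k f g => [|k IH] f g /=.
  by move=> cf cg x Vx; apply: continuousD; [exact: cf|exact: cg].
move=> [df Df] [dg Dg]; split=> [x Vx|a].
  by apply: differentiableD; [exact: df|exact: dg].
apply: (Ck_ext _ _ (IH _ _ (Df a) (Dg a))) => // x Vx.
by rewrite deriveD//; apply: diff_derivable; [exact: df|exact: dg].
Qed.

Lemma CkM k V f g : open V -> Ck k V f -> Ck k V g -> Ck k V (f * g).
Proof.
move=> oV; elim: k f g => [|k IH] f g.
  by move=> cf cg x Vx; apply: continuousM; [exact: cf|exact: cg].
move=> Cf Cg; have [[df Df] [dg Dg]] := (Cf, Cg); split=> [x Vx|a].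
  by apply: differentiableM; [exact: df|exact: dg].
have Cf' := Ck_pred Cf; have Cg' := Ck_pred Cg.
apply: (Ck_ext _ _ (CkD oV (IH _ _ Cf' (Dg a)) (IH _ _ Cg' (Df a)))) => // x Vx.
by rewrite deriveM//; apply: diff_derivable; [exact: df|exact: dg].
Qed.

Lemma CkV k V f : open V -> (forall x, V x -> f x != 0) ->
  Ck k V f -> Ck k V (fun x => (f x)^-1).
Proof.
move=> oV f0; elim: k => [|k IH] Cf.
  by move=> x Vx; apply: continuousV; [exact: f0|exact: Cf].
have [df Df] := Cf; split=> [x Vx|a].
  by apply: differentiableV; [exact: df|exact: f0].
have CV := IH (Ck_pred Cf).
apply: (Ck_ext _ _ (CkM oV (CkM oV (Ck_cst k (-1) oV) (Df a)) (CkM oV CV CV))) => // x Vx.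
rewrite deriveV; [|exact: f0|by apply: diff_derivable; exact: df].
by rewrite !fctE /= expr2 invfM mulN1r scaleNr /GRing.scale /= mulNr mulrC.
Qed.

Lemma Csmooth_ext V f g : open V -> (forall y, V y -> f y = g y) ->
  Csmooth V f -> Csmooth V g.
Proof. by move=> oV fg Cf k; apply: Ck_ext (Cf k). Qed.

Lemma Csmooth_sub V V' f : V' `<=` V -> Csmooth V f -> Csmooth V' f.
Proof. by move=> V'V Cf k; apply: Ck_sub (Cf k). Qed.

Lemma Csmooth_cst V (c : R) : open V -> Csmooth V (fun=> c).
Proof. by move=> oV k; exact: Ck_cst. Qed.

Lemma CsmoothD V f g : open V -> Csmooth V f -> Csmooth V g ->
  Csmooth V (fun x => f x + g x).
Proof. by move=> oV Cf Cg k; exact: CkD. Qed.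

Lemma CsmoothM V f g : open V -> Csmooth V f -> Csmooth V g ->
  Csmooth V (fun x => f x * g x).
Proof. by move=> oV Cf Cg k; exact: CkM. Qed.

Lemma CsmoothN V f : open V -> Csmooth V f -> Csmooth V (fun x => - f x).
Proof.
move=> oV Cf; apply: (Csmooth_ext _ _ (CsmoothM oV (Csmooth_cst (-1) oV) Cf)) => //.
by move=> y _; rewrite mulN1r.
Qed.

Lemma CsmoothB V f g : open V -> Csmooth V f -> Csmooth V g ->
  Csmooth V (fun x => f x - g x).
Proof. by move=> oV Cf Cg; apply: CsmoothD => //; exact: CsmoothN. Qed.

Lemma CsmoothV V f : open V -> (forall x, V x -> f x != 0) ->
  Csmooth V f -> Csmooth V (fun x => (f x)^-1).
Proof. by move=> oV f0 Cf k; exact: CkV. Qed.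

Lemma CsmoothX V f n : open V -> Csmooth V f -> Csmooth V (fun x => f x ^+ n).
Proof.
move=> oV Cf; elim: n => [|n IH]; first exact: Csmooth_cst.
by under eq_fun do rewrite exprS; exact: CsmoothM.
Qed.

Lemma Csmooth_sum V (I : Type) (r : seq I) (P : pred I)
    (F : I -> 'rV[R]_d -> R) : open V -> (forall i, P i -> Csmooth V (F i)) ->
  Csmooth V (fun x => \sum_(i <- r | P i) F i x).
Proof.
move=> oV CF; elim: r => [|i r IH].
  by apply: (Csmooth_ext oV _ (Csmooth_cst 0 oV)) => y _; rewrite big_nil.
case Pi: (P i); last first.
  by apply: Csmooth_ext IH => // y _; rewrite big_cons Pi.
apply: (Csmooth_ext oV _ (CsmoothD oV (CF i Pi) IH)) => y _.
by rewrite big_cons Pi.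
Qed.

Lemma Csmooth_prod V (I : Type) (r : seq I) (P : pred I)
    (F : I -> 'rV[R]_d -> R) : open V -> (forall i, P i -> Csmooth V (F i)) ->
  Csmooth V (fun x => \prod_(i <- r | P i) F i x).
Proof.
move=> oV CF; elim: r => [|i r IH].
  by apply: (Csmooth_ext oV _ (Csmooth_cst 1 oV)) => y _; rewrite big_nil.
case Pi: (P i); last first.
  by apply: Csmooth_ext IH => // y _; rewrite big_cons Pi.
apply: (Csmooth_ext oV _ (CsmoothM oV (CF i Pi) IH)) => y _.
by rewrite big_cons Pi.
Qed.

Lemma Csmooth_derive V f a : Csmooth V f -> Csmooth V (fun x => 'D_('e_a) f x).
Proof. by move=> Cf k; have [_] := Cf k.+1; apply. Qed.

Lemma Csmooth_differentiable V f x : Csmooth V f -> V x -> differentiable f x.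
Proof. by move=> Cf Vx; have [df _] := Cf 1; exact: df. Qed.

Lemma Csmooth_continuous V f x : Csmooth V f -> V x -> {for x, continuous f}.
Proof. by move=> Cf; exact: (Cf 0). Qed.

(** Reduces statements about partial derivatives to the one-variable mean
    value theorem. *)
Lemma is_derive_line (U : normedModType R) (f : U -> R) (x v : U) (t : R) :
  differentiable f (x + t *: v) ->
  is_derive t 1 (fun s => f (x + s *: v)) ('D_v f (x + t *: v)).
Proof.
move=> df.
have dl : is_diff t (cst x + ( *:%R ^~ v) : R -> U) (0 + ( *:%R ^~ v)).
  exact: is_diffD.
have dcomp := differentiable_comp (@ex_diff _ _ _ _ _ _ _ dl) df.
apply: DeriveDef; first exact/diff_derivable.
rewrite deriveE // diff_comp //= (@diff_val _ _ _ _ _ _ _ dl) deriveE //.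
by rewrite !fctE add0r scale1r.
Qed.

End SmoothFunctions.

(** * Mean value arguments and the chain rule *)

Section MeanValue.
Context {R : realType} {d : nat}.
Implicit Types (V : set 'rV[R]_d) (f g : 'rV[R]_d -> R) (x v w : 'rV[R]_d).

Lemma normr_delta a : `|'e_a : 'rV[R]_d| <= 1.
Proof.
rewrite [leLHS]/Num.Def.normr/= mx_normrE bigmax_le //= => -[i j] _ /=.
by rewrite mxE; case: (_ && _); rewrite ?normr1 ?normr0.
Qed.

Lemma mean_value (h : R) (f f' : R -> R) : 0 < h ->
  (forall s, 0 <= s <= h -> is_derive s 1 f (f' s)) ->
  exists2 s, 0 <= s <= h & f h - f 0 = f' s * h.
Proof.
move=> h0 df.
have df' s : s \in `]0, h[%R -> is_derive s 1 f (f' s).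
  by rewrite in_itv /= => /andP[/ltW ? /ltW ?]; apply: df; apply/andP.
have cf : {within `[0, h], continuous f}.
  apply: derivable_within_continuous => s; rewrite in_itv /= => sh.
  exact: (@ex_derive _ _ _ _ _ _ _ (df s sh)).
have [s sh Es] := MVT h0 df' cf.
exists s; last by rewrite Es subr0.
by move: sh; rewrite in_itv /= => /andP[/ltW -> /ltW ->].
Qed.

(** The mean value theorem applied twice, first along [a] and then along [b].
    The left-hand side is symmetric in [a] and [b], which is what makes the
    mixed partial derivatives agree. *)
Lemma second_difference x (r h : R) f a b :
  Csmooth (ball x r) f -> 0 < h -> h + h < r ->
  exists2 y, ball x r y &
    f (x + h *: 'e_b + h *: 'e_a) - f (x + h *: 'e_a)
      - (f (x + h *: 'e_b) - f x)
    = h * h * 'D_('e_b) (fun z => 'D_('e_a) f z) y.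
Proof.
move=> Cf h0 hr.
have inB s t : 0 <= s <= h -> 0 <= t <= h -> ball x r (x + t *: 'e_b + s *: 'e_a).
  move=> /andP[s0 sh] /andP[t0 th]; rewrite -ball_normE /= -addrA opprD addNKr.
  rewrite normrN (le_lt_trans (ler_normD _ _))// (le_lt_trans _ hr)// lerD//.
    by rewrite normrZ ger0_norm// (le_trans _ th)// ler_piMr// normr_delta.
  by rewrite normrZ ger0_norm// (le_trans _ sh)// ler_piMr// normr_delta.
have h0h : 0 <= h <= h by rewrite lexx ltW.
have zh : 0 <= (0 : R) <= h by rewrite lexx ltW.
have dline g t s : Csmooth (ball x r) g -> 0 <= s <= h -> 0 <= t <= h ->
    is_derive s 1 (fun s => g (x + t *: 'e_b + s *: 'e_a))
      ('D_('e_a) g (x + t *: 'e_b + s *: 'e_a)).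
  move=> Cg sh th; apply: is_derive_line.
  by apply: Csmooth_differentiable Cg _; exact: inB.
have dline' g t s : Csmooth (ball x r) g -> 0 <= s <= h -> 0 <= t <= h ->
    is_derive t 1 (fun t => g (x + s *: 'e_a + t *: 'e_b))
      ('D_('e_b) g (x + s *: 'e_a + t *: 'e_b)).
  move=> Cg sh th; apply: is_derive_line.
  by rewrite addrAC; apply: Csmooth_differentiable Cg _; exact: inB.
pose phi (s : R) : R := f (x + h *: 'e_b + s *: 'e_a) - f (x + 0 *: 'e_b + s *: 'e_a).
pose phi' (s : R) : R := 'D_('e_a) f (x + h *: 'e_b + s *: 'e_a) -
  'D_('e_a) f (x + 0 *: 'e_b + s *: 'e_a).
have dphi s : 0 <= s <= h -> is_derive s 1 phi (phi' s).
  by move=> sh; exact: is_deriveB (dline f h s Cf sh h0h) (dline f 0 s Cf sh zh).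
have [s sh Es] := mean_value h0 dphi.
have CDf := Csmooth_derive a Cf.
pose psi (t : R) : R := 'D_('e_a) f (x + s *: 'e_a + t *: 'e_b).
pose psi' (t : R) : R :=
  'D_('e_b) (fun z => 'D_('e_a) f z) (x + s *: 'e_a + t *: 'e_b).
have dpsi t : 0 <= t <= h -> is_derive t 1 psi (psi' t).
  by move=> th; exact: dline' (fun z => 'D_('e_a) f z) t s CDf sh th.
have [t th Et] := mean_value h0 dpsi.
exists (x + s *: 'e_a + t *: 'e_b); first by rewrite addrAC; exact: inB.
move: Es Et; rewrite /phi /psi /phi' /psi' !scale0r !addr0.
rewrite [x + h *: 'e_b + s *: 'e_a]addrAC => Es Et.
by rewrite Es Et mulrC mulrA mulrAC -mulrA mulrC -mulrA.
Qed.

Lemma close_on_ball V (G H : 'rV[R]_d -> R) x (e : R) : open V -> V x ->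
  {for x, continuous G} -> {for x, continuous H} -> 0 < e ->
  exists2 r : R, 0 < r & forall y, ball x r y ->
    [/\ V y, `|G x - G y| < e & `|H x - H y| < e].
Proof.
move=> oV Vx cG cH e0.
have /cvgrPdist_lt/(_ e e0) nG' := cG.
have /cvgrPdist_lt/(_ e e0) nH' := cH.
have nV : \near x, V x := open_nbhs_nbhs (conj oV Vx).
have [r /= r0 rB] := (nbhs_ballP _ _).1 (filterI nV (filterI nG' nH')).
by exists r => // y /rB[? [? ?]].
Qed.

(** Schwarz: if the two mixed derivatives at [x] differed, then by continuity
    they would differ at all pairs of points of a small ball, while
    [second_difference] yields two points of the ball where they agree. *)
Lemma derive_comm V f a b x : open V -> Csmooth V f -> V x ->
  'D_('e_a) (fun y => 'D_('e_b) f y) x = 'D_('e_b) (fun y => 'D_('e_a) f y) x.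
Proof.
move=> oV Cf Vx; apply/eqP; rewrite -subr_eq0 -normr_le0 leNgt; apply/negP.
set L := (X in `|X - _|); set L' := (X in `|_ - X|) => LL'; pose e := `|L - L'| / 2.
have e0 : 0 < e by rewrite divr_gt0.
have cont a' b' : {for x, continuous (fun y => 'D_('e_a') (fun y => 'D_('e_b') f y) y)}.
  by apply: Csmooth_continuous Vx; do 2 apply: Csmooth_derive.
have [r r0 rB] := close_on_ball oV Vx (cont a b) (cont b a) e0.
have Cr : Csmooth (ball x r) f by apply: Csmooth_sub Cf => y /rB[].
(* The corners of the square of side h stay in the ball of radius r. *)
pose h := r / 4.
have h0 : 0 < h by rewrite divr_gt0.
have hr : h + h < r by rewrite /h; lra.
have [y By Ey] := second_difference b a Cr h0 hr.
have [z Bz Ez] := second_difference a b Cr h0 hr.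
have hh : h * h != 0 by rewrite mulf_neq0 ?gt_eqF.
have EE : 'D_('e_a) (fun z => 'D_('e_b) f z) y = 'D_('e_b) (fun z => 'D_('e_a) f z) z.
  apply: (mulfI hh); apply: etrans (esym Ey) _; apply: etrans _ Ez.
  by rewrite [x + h *: 'e_a + _]addrAC; ring.
have [_ Ly _] := rB _ By; have [_ _ Lz] := rB _ Bz.
suff key (l l' p q : R) : p = q -> `|l - p| < `|l - l'| / 2 ->
  `|l' - q| < `|l - l'| / 2 -> False by exact: key EE Ly Lz.
move=> -> lq l'q; have := ler_distD q l l'.
by rewrite (distrC q); clear -lq l'q; lra.
Qed.

Lemma derive_coord f x v : differentiable f x ->
  'D_v f x = \sum_a v ord0 a * 'D_('e_a) f x.
Proof.
move=> df; rewrite deriveE// {1}(row_sum_delta v) linear_sum/=.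
by apply: eq_bigr => a _; rewrite linearZ /= -deriveE.
Qed.

Lemma ball_convex x (r : R) y z (t : R) : ball x r y -> ball x r z -> 0 <= t <= 1 ->
  ball x r (y + t *: (z - y)).
Proof.
rewrite -!ball_normE /= => By Bz /andP[t0 t1].
have -> : x - (y + t *: (z - y)) = (1 - t) *: (x - y) + t *: (x - z).
  by apply/rowP => i; rewrite !mxE; ring.
apply: (le_lt_trans (ler_normD _ _)); rewrite !normrZ !ger0_norm ?subr_ge0//.
move: By Bz; move: `|x - y| `|x - z| => p q pr qr.
have [|tn0] := eqVneq t 0; first by move=> ->; lra.
have tp : 0 < t by rewrite lt_neqAle eq_sym tn0.
have : t * q < t * r by rewrite ltr_pM2l.
have : (1 - t) * p <= (1 - t) * r by rewrite ler_wpM2l ?subr_ge0// ltW.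
lra.
Qed.

(** Balls are convex, and the derivative along the segment joining two points
    is a combination of the partial derivatives. *)
Lemma gradient0_cst x (r : R) f :
  (forall y, ball x r y -> differentiable f y) ->
  (forall a y, ball x r y -> 'D_('e_a) f y = 0) ->
  forall y z, ball x r y -> ball x r z -> f y = f z.
Proof.
move=> df Df y z By Bz.
pose F (t : R) : R := f (y + t *: (z - y)).
have dF (t : R) : 0 <= t <= 1 -> is_derive t 1 F ((fun=> 0) t).
  move=> t01; have Bt := ball_convex By Bz t01.
  have dft := is_derive_line (df _ Bt); apply: is_derive_eq dft _.
  by rewrite derive_coord ?big1// => [a _|]; [rewrite Df ?mulr0|exact: df].
have [t _] := mean_value ltr01 dF.
rewrite /F scale0r addr0 scale1r addrCA subrr addr0 mul0r => /eqP.
by rewrite subr_eq0 => /eqP.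
Qed.

Lemma differentiable_row (e : nat) (phi : 'rV[R]_d -> 'rV[R]_e) x :
  (forall b, differentiable (fun y => phi y ord0 b) x) -> differentiable phi x.
Proof.
move=> dphi; have -> : phi = \sum_b (fun y => phi y ord0 b *: 'e_b).
  by apply: funext => y; rewrite fct_sumE; exact: row_sum_delta.
by apply: differentiable_sum => b; exact: differentiableZl.
Qed.

Lemma jacobianE (phi : 'rV[R]_d -> 'rV[R]_d) x a b :
  (forall b, differentiable (fun y => phi y ord0 b) x) ->
  jacobian phi x a b = 'D_('e_a) (fun y => phi y ord0 b) x.
Proof.
move=> dphi; have dp := differentiable_row dphi.
have : 'D_('e_a) phi x = 'e_a *m jacobian phi x by exact: deriveEjacobian.
rewrite -rowE => /rowP/(_ b); rewrite [RHS]mxE => <-.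
by rewrite derive_mx ?mxE//; exact: diff_derivable.
Qed.

Lemma chain_rule (phi : 'rV[R]_d -> 'rV[R]_d) f x a :
  (forall b, differentiable (fun y => phi y ord0 b) x) ->
  differentiable f (phi x) ->
  'D_('e_a) (fun y => f (phi y)) x =
    \sum_b jacobian phi x a b * 'D_('e_b) f (phi x).
Proof.
move=> dphi df; have dp := differentiable_row dphi.
rewrite -[fun y => f _]/(f \o phi) deriveE; last exact: differentiable_comp.
rewrite diff_comp //= -deriveE // derive_coord//.
by apply: eq_bigr => b _; rewrite -mul_rV_lin1 -rowE mxE.
Qed.

End MeanValue.

(** * Partial derivatives of matrix-valued functions *)

HB.lock Definition dmx (R : realType) (d p q : nat) (a : 'I_d)
    (G : 'rV[R]_d -> 'M[R]_(p, q)) (x : 'rV[R]_d) : 'M[R]_(p, q) :=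
  \matrix_(i, j) 'D_('e_a) (fun y => G y i j) x.

Section MatrixCalculus.
Context {R : realType} {d : nat}.
Implicit Types (V : set 'rV[R]_d) (x : 'rV[R]_d).

Lemma dmxE p q (a : 'I_d) (G : 'rV[R]_d -> 'M[R]_(p, q)) x i j :
  dmx a G x i j = 'D_('e_a) (fun y => G y i j) x.
Proof. by rewrite [dmx]unlock mxE. Qed.

Definition mdiff p q (G : 'rV[R]_d -> 'M[R]_(p, q)) x : Prop :=
  forall i j, differentiable (fun y => G y i j) x.

Definition msmooth p q V (G : 'rV[R]_d -> 'M[R]_(p, q)) : Prop :=
  forall i j, Csmooth V (fun y => G y i j).

Lemma derive_fD (f g : 'rV[R]_d -> R) x v :
  differentiable f x -> differentiable g x ->
  'D_v (fun y => f y + g y) x = 'D_v f x + 'D_v g x.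
Proof. by move=> df dg; rewrite -deriveD//; exact: diff_derivable. Qed.

Lemma derive_fB (f g : 'rV[R]_d -> R) x v :
  differentiable f x -> differentiable g x ->
  'D_v (fun y => f y - g y) x = 'D_v f x - 'D_v g x.
Proof. by move=> df dg; rewrite -deriveB//; exact: diff_derivable. Qed.

Lemma derive_fM (f g : 'rV[R]_d -> R) x v :
  differentiable f x -> differentiable g x ->
  'D_v (fun y => f y * g y) x = 'D_v f x * g x + f x * 'D_v g x.
Proof.
move=> df dg; rewrite -[fun y => _]/(f * g) deriveM; try exact: diff_derivable.
by rewrite addrC /GRing.scale /= mulrC.
Qed.

Lemma derive_fsum (I : finType) (F : I -> 'rV[R]_d -> R) x v :
  (forall i, differentiable (F i) x) ->
  'D_v (fun y => \sum_i F i y) x = \sum_i 'D_v (F i) x.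
Proof.
move=> dF.
have H (r : seq I) : differentiable (fun y => \sum_(i <- r) F i y) x /\
    'D_v (fun y => \sum_(i <- r) F i y) x = \sum_(i <- r) 'D_v (F i) x.
  elim: r => [|i r [IH1 IH2]].
    have -> : (fun y => \sum_(i <- [::]) F i y) = cst 0.
      by apply: funext => y; rewrite big_nil.
    by rewrite big_nil derive_cst; split=> //; exact: differentiable_cst.
  have -> : (fun y => \sum_(j <- i :: r) F j y) =
            (fun y => F i y + \sum_(j <- r) F j y).
    by apply: funext => y; rewrite big_cons.
  by rewrite big_cons derive_fD// IH2; split=> //; exact: differentiableD.
by have [] := H (index_enum I).
Qed.

Lemma differentiable_fsum (I : finType) (F : I -> 'rV[R]_d -> R) x :
  (forall i, differentiable (F i) x) ->
  differentiable (fun y => \sum_i F i y) x.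
Proof.
move=> dF; elim: (index_enum I) => [|i r IH].
  have -> : (fun y => \sum_(i <- [::]) F i y) = cst 0.
    by apply: funext => y; rewrite big_nil.
  exact: differentiable_cst.
have -> : (fun y => \sum_(j <- i :: r) F j y) =
          (fun y => F i y + \sum_(j <- r) F j y).
  by apply: funext => y; rewrite big_cons.
exact: differentiableD.
Qed.

Lemma derive_fV (f : 'rV[R]_d -> R) x v :
  differentiable f x -> f x != 0 ->
  'D_v (fun y => (f y)^-1) x = - ((f x)^-1 ^+ 2 * 'D_v f x).
Proof.
move=> df f0; rewrite deriveV//; last exact: diff_derivable.
by rewrite scaleNr /GRing.scale /= exprVn.
Qed.

Lemma derive_near (f g : 'rV[R]_d -> R) V x v : open V -> V x ->
  (forall y, V y -> f y = g y) -> 'D_v f x = 'D_v g x.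
Proof.
by move=> oV Vx fg; apply: near_eq_derive; exact: open_near_eq oV fg Vx.
Qed.

Lemma dmx_near p q (G H : 'rV[R]_d -> 'M[R]_(p, q)) V x a : open V -> V x ->
  (forall y, V y -> G y = H y) -> dmx a G x = dmx a H x.
Proof.
move=> oV Vx GH; apply/matrixP => i j; rewrite !dmxE.
by apply: derive_near oV Vx _ => y /GH ->.
Qed.

Lemma dmxM p q r (G : 'rV[R]_d -> 'M[R]_(p, q)) (H : 'rV[R]_d -> 'M[R]_(q, r)) x a :
  mdiff G x -> mdiff H x ->
  dmx a (fun y => G y *m H y) x = dmx a G x *m H x + G x *m dmx a H x.
Proof.
move=> dG dH; apply/matrixP => i j; rewrite dmxE !mxE -big_split /=.
under eq_fun do rewrite mxE.
rewrite derive_fsum => [|k]; last exact: differentiableM.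
by apply: eq_bigr => k _; rewrite derive_fM// !dmxE.
Qed.

Lemma dmxD p q (G H : 'rV[R]_d -> 'M[R]_(p, q)) x a :
  mdiff G x -> mdiff H x ->
  dmx a (fun y => G y + H y) x = dmx a G x + dmx a H x.
Proof.
move=> dG dH; apply/matrixP => i j; rewrite dmxE mxE !dmxE.
under eq_fun do rewrite mxE.
by rewrite derive_fD.
Qed.

Lemma dmx_tr p q (G : 'rV[R]_d -> 'M[R]_(p, q)) x a :
  dmx a (fun y => (G y)^T) x = (dmx a G x)^T.
Proof.
by apply/matrixP => i j; rewrite mxE !dmxE; under eq_fun do rewrite mxE.
Qed.

Lemma mdiffM p q r (G : 'rV[R]_d -> 'M[R]_(p, q)) (H : 'rV[R]_d -> 'M[R]_(q, r)) x :
  mdiff G x -> mdiff H x -> mdiff (fun y => G y *m H y) x.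
Proof.
move=> dG dH i j; under eq_fun do rewrite mxE.
by apply: differentiable_fsum => k; exact: differentiableM.
Qed.

Lemma mdiff_tr p q (G : 'rV[R]_d -> 'M[R]_(p, q)) x :
  mdiff G x -> mdiff (fun y => (G y)^T) x.
Proof. by move=> dG i j; under eq_fun do rewrite mxE. Qed.

Lemma msmooth_mdiff p q V (G : 'rV[R]_d -> 'M[R]_(p, q)) x :
  msmooth V G -> V x -> mdiff G x.
Proof. by move=> sG Vx i j; exact: Csmooth_differentiable (sG i j) Vx. Qed.

Lemma msmooth_sub p q V V' (G : 'rV[R]_d -> 'M[R]_(p, q)) :
  V' `<=` V -> msmooth V G -> msmooth V' G.
Proof. by move=> V'V sG i j; exact: Csmooth_sub (sG i j). Qed.

Lemma msmoothM p q r V (G : 'rV[R]_d -> 'M[R]_(p, q)) (H : 'rV[R]_d -> 'M[R]_(q, r)) :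
  open V -> msmooth V G -> msmooth V H -> msmooth V (fun y => G y *m H y).
Proof.
move=> oV sG sH i j; under eq_fun do rewrite mxE.
by apply: Csmooth_sum => // k _; exact: CsmoothM.
Qed.

Lemma msmoothD p q V (G H : 'rV[R]_d -> 'M[R]_(p, q)) :
  open V -> msmooth V G -> msmooth V H -> msmooth V (fun y => G y + H y).
Proof.
by move=> oV sG sH i j; under eq_fun do rewrite mxE; exact: CsmoothD.
Qed.

Lemma msmoothN p q V (G : 'rV[R]_d -> 'M[R]_(p, q)) :
  open V -> msmooth V G -> msmooth V (fun y => - G y).
Proof.
by move=> oV sG i j; under eq_fun do rewrite mxE; exact: CsmoothN.
Qed.

Lemma msmooth_dmx p q V (G : 'rV[R]_d -> 'M[R]_(p, q)) a :
  msmooth V G -> msmooth V (dmx a G).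
Proof.
by move=> sG i j; under eq_fun do rewrite dmxE; exact: Csmooth_derive.
Qed.

Lemma dmx_comm p q V (G : 'rV[R]_d -> 'M[R]_(p, q)) a b x :
  open V -> msmooth V G -> V x -> dmx a (dmx b G) x = dmx b (dmx a G) x.
Proof.
move=> oV sG Vx; apply/matrixP => i j; rewrite [LHS]dmxE [RHS]dmxE.
have dE c : (fun y => dmx c G y i j) = (fun y => 'D_('e_c) (fun z => G z i j) y).
  by apply: funext => y; rewrite dmxE.
rewrite !dE. exact: (derive_comm a b oV (sG i j) Vx).
Qed.

Lemma Csmooth_det p V (G : 'rV[R]_d -> 'M[R]_p) :
  open V -> msmooth V G -> Csmooth V (fun x => \det (G x)).
Proof.
move=> oV sG; apply: Csmooth_sum => // s _; apply: CsmoothM => //.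
  exact: Csmooth_cst.
by apply: Csmooth_prod => // i _.
Qed.

Lemma msmooth_invmx p V (G : 'rV[R]_d -> 'M[R]_p) :
  open V -> msmooth V G -> (forall x, V x -> G x \in unitmx) ->
  msmooth V (fun x => invmx (G x)).
Proof.
move=> oV sG uG i j.
have sadj : Csmooth V (fun x => (\det (G x))^-1 * (\adj (G x)) i j).
  apply: CsmoothM => //.
    apply: CsmoothV => //; last exact: Csmooth_det.
    by move=> x /uG; rewrite unitmxE unitfE.
  under eq_fun do rewrite mxE.
  apply: CsmoothM => //; first exact: Csmooth_cst.
  by apply: Csmooth_det => // k l; under eq_fun do rewrite !mxE; exact: sG.
apply: (Csmooth_ext oV _ sadj) => x Vx.
by rewrite /invmx (uG x Vx) [RHS]mxE.
Qed.

End MatrixCalculus.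

(** * Connections as matrices: curvature and gauge transformations *)

Lemma addmxE (R : nmodType) p q (A B : 'M[R]_(p, q)) i j : (A + B) i j = A i j + B i j.
Proof. by rewrite mxE. Qed.

Lemma oppmxE (R : zmodType) p q (A : 'M[R]_(p, q)) i j : (- A) i j = - A i j.
Proof. by rewrite mxE. Qed.

Lemma zeromxE (R : nmodType) p q i j : (0 : 'M[R]_(p, q)) i j = 0.
Proof. by rewrite mxE. Qed.

Lemma addmx_tr (R : nmodType) p q (A B : 'M[R]_(p, q)) : (A + B)^T = A^T + B^T.
Proof. by apply/matrixP => i j; rewrite !mxE. Qed.

Lemma oppmx_tr (R : zmodType) p q (A : 'M[R]_(p, q)) : (- A)^T = - A^T.
Proof. by apply/matrixP => i j; rewrite !mxE. Qed.

(** Decides identities in the noncommutative ring of matrices: both sides are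
    expanded into sums of products, and the entries of the products are left as
    atoms to a commutative normalisation. *)
Ltac mxring :=
  rewrite ?(trmx_mul, addmx_tr, oppmx_tr, trmxK);
  rewrite ?(mulmxDl, mulmxDr, mulmxBl, mulmxBr, mulmxN, mulNmx, mulmxA);
  apply/matrixP => ? ?; rewrite ?(addmxE, oppmxE, zeromxE); ring.

(** Replaces the values at [x] of matrix-valued functions and of their
    derivatives by variables, so that they are compared syntactically. *)
Ltac gen_atoms x :=
  repeat match goal with |- context [dmx ?a ?F x] =>
    let t := fresh "t" in move: (dmx a F x) => t end;
  repeat match goal with |- context [?A x] =>
    match type of (A x) with matrix _ _ _ =>
    let t := fresh "t" in move: (A x) => t end end.

Section Local.
Context {R : realType} {d : nat}.
Implicit Types (V : set 'rV[R]_d) (x y : 'rV[R]_d) (a b c e f : 'I_d).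
Local Notation E := 'rV[R]_d.
Local Notation Mat := 'M[R]_d.

(** Entry [(e, c)] is the component R_ab^c_e, for [(A a) b c = Gamma_ab^c]. The
    signs of the two products are those of matrices acting on row vectors. *)
Definition curv (A : 'I_d -> E -> Mat) a b x : Mat :=
  dmx a (A b) x - dmx b (A a) x + A b x *m A a x - A a x *m A b x.

(** The contraction R_ca^c_b. *)
Definition ric (A : 'I_d -> E -> Mat) x : Mat :=
  \matrix_(a, b) \sum_c curv A c a x b c.

Lemma curvC A a b x : curv A a b x = - curv A b a x.
Proof. rewrite /curv; gen_atoms x; mxring. Qed.

Lemma msmooth_curv V A a b : open V -> (forall a, msmooth V (A a)) ->
  msmooth V (curv A a b).
Proof.
move=> oV sA; have sdA c e : msmooth V (dmx c (A e)) by exact: msmooth_dmx.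
by rewrite /curv; do ?[apply: msmoothD => //|apply: msmoothN => //|apply: msmoothM => //].
Qed.

Lemma msmooth_ric V A : open V -> (forall a, msmooth V (A a)) ->
  msmooth V (ric A).
Proof.
move=> oV sA a b; have -> : (fun y => ric A y a b) = fun y => \sum_c curv A c a y b c.
  by apply: funext => y; rewrite mxE.
by apply: Csmooth_sum => // c _; exact: msmooth_curv.
Qed.

Lemma dmxB p q (F H : E -> 'M[R]_(p, q)) x a :
  mdiff F x -> mdiff H x -> dmx a (fun y => F y - H y) x = dmx a F x - dmx a H x.
Proof.
move=> dF dH; apply/matrixP => i j; rewrite addmxE oppmxE !dmxE.
under eq_fun do rewrite addmxE oppmxE.
by rewrite derive_fB.
Qed.

(** Second Bianchi identity. The [D a b c] are covariant derivatives of the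
    curvature with respect to its endomorphism indices only: the remaining
    Christoffel symbols cancel in the cyclic sum when there is no torsion. What
    is left is the Jacobi identity and the symmetry of second derivatives. *)
Lemma bianchi2 V A a b c x : open V -> (forall a, msmooth V (A a)) -> V x ->
  let D a b c := dmx a (curv A b c) x + curv A b c x *m A a x - A a x *m curv A b c x in
  D a b c + D b c a + D c a b = 0.
Proof.
move=> oV sA Vx /=; have sdA e f : msmooth V (dmx e (A f)) by exact: msmooth_dmx.
have dA e : mdiff (A e) x := msmooth_mdiff (sA e) Vx.
have ddA e f : mdiff (dmx e (A f)) x := msmooth_mdiff (sdA e f) Vx.
have dcurv e f g : dmx e (curv A f g) x =
    dmx e (dmx f (A g)) x - dmx e (dmx g (A f)) x
    + (dmx e (A g) x *m A f x + A g x *m dmx e (A f) x)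
    - (dmx e (A f) x *m A g x + A f x *m dmx e (A g) x).
  have s1 : msmooth V (fun y => dmx f (A g) y - dmx g (A f) y).
    by apply: msmoothD => //; exact: msmoothN.
  have s2 h k : msmooth V (fun y => A h y *m A k y) by exact: msmoothM.
  rewrite /curv dmxB; last exact: msmooth_mdiff Vx.
    rewrite dmxD; last exact: msmooth_mdiff Vx.
      by rewrite dmxB// !dmxM.
    exact: msmooth_mdiff Vx.
  by apply: msmooth_mdiff Vx; exact: msmoothD.
rewrite !dcurv /curv (dmx_comm b a oV (sA c) Vx) (dmx_comm c a oV (sA b) Vx).
rewrite (dmx_comm c b oV (sA a) Vx).
clear; gen_atoms x; mxring.
Qed.

(** The hypothesis says that [J] intertwines the covariant derivatives of [A]
    and [B]: [(D_A v) J = D_B (v J)] for every row vector [v]. Differentiating it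
    once more and antisymmetrising gives the claim, without inverting [J]. *)
Lemma gauge_curv V A B (J : E -> Mat) a b x : open V -> V x -> msmooth V J ->
  (forall a, mdiff (A a) x) -> (forall a, mdiff (B a) x) ->
  (forall y a, V y -> A a y *m J y = dmx a J y + J y *m B a y) ->
  curv A a b x *m J x = J x *m curv B a b x.
Proof.
move=> oV Vx sJ dA dB AJ; have dJ := msmooth_mdiff sJ Vx.
have ddJ c : mdiff (dmx c J) x by apply: msmooth_mdiff Vx; exact: msmooth_dmx.
have H e f : dmx e (A f) x *m J x = dmx e (dmx f J) x + dmx e J x *m B f x
      + J x *m dmx e (B f) x - A f x *m dmx e J x.
  have : dmx e (fun y => A f y *m J y) x = dmx e (fun y => dmx f J y + J y *m B f y) x.
    by apply: dmx_near oV Vx _ => y Vy; exact: AJ.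
  rewrite dmxM// dmxD//; last exact: mdiffM.
  by rewrite dmxM// addrA => <-; rewrite addrK.
have dJE e : dmx e J x = A e x *m J x - J x *m B e x by rewrite AJ// addrK.
rewrite /curv !(mulmxDl, mulNmx) !H (dmx_comm b a oV sJ Vx) !dJE.
clear; gen_atoms x; mxring.
Qed.

End Local.

(** * The Levi-Civita connection in a chart *)

Section Metric.
Context {R : realType} {d : nat}.
Implicit Types (V : set 'rV[R]_d) (x y : 'rV[R]_d) (a b c e f : 'I_d).
Local Notation E := 'rV[R]_d.
Local Notation Mat := 'M[R]_d.

(** The Christoffel symbols of the first kind. *)
Definition lowered (G : E -> Mat) a x : Mat := \matrix_(b, c)
  (2^-1 * (dmx a G x b c + dmx b G x a c - dmx c G x a b)).

Lemma loweredE G a x b c : lowered G a x b c =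
  2^-1 * (dmx a G x b c + dmx b G x a c - dmx c G x a b).
Proof. by rewrite mxE. Qed.

(** Entry [(b, c)] is Gamma_ab^c. *)
Definition chr (G : E -> Mat) a x : Mat := lowered G a x *m invmx (G x).

Definition semi_riemannian V (G : E -> Mat) : Prop :=
  [/\ open V, msmooth V G, forall x, V x -> (G x)^T = G x &
      forall x, V x -> G x \in unitmx].

Lemma semi_riemannian_sub V V' G : open V' -> V' `<=` V -> semi_riemannian V G ->
  semi_riemannian V' G.
Proof.
move=> oV' V'V [_ sG GT uG]; split=> // [|x /V'V|x /V'V].
- exact: msmooth_sub sG.
- exact: GT.
- exact: uG.
Qed.

Section AtMetric.
Context {V : set E} {G : E -> Mat} (mG : semi_riemannian V G).
Let oV : open V. Proof. by case: mG. Qed.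
Let sG : msmooth V G. Proof. by case: mG. Qed.
Let GT x : V x -> (G x)^T = G x. Proof. by case: mG => _ _ h _; exact: h. Qed.
Let uG x : V x -> G x \in unitmx. Proof. by case: mG => _ _ _; exact. Qed.

Lemma msmooth_inv : msmooth V (fun x => invmx (G x)).
Proof. exact: msmooth_invmx. Qed.

Lemma msmooth_chr a : msmooth V (chr G a).
Proof.
apply: msmoothM => //; last exact: msmooth_inv.
move=> b c; have -> : (fun y => lowered G a y b c) = (fun y =>
    2^-1 * (dmx a G y b c + dmx b G y a c - dmx c G y a b)).
  by apply: funext => y; rewrite loweredE.
have sdG e : msmooth V (dmx e G) by exact: msmooth_dmx.
apply: CsmoothM => //; first exact: Csmooth_cst.
apply: CsmoothB => //; last exact: sdG.
by apply: CsmoothD => //; exact: sdG.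
Qed.

Lemma dmx_metric_sym a x : V x -> (dmx a G x)^T = dmx a G x.
Proof.
by move=> Vx; rewrite -dmx_tr; apply: dmx_near oV Vx _ => y; exact: GT.
Qed.

Lemma dmx_metricC a x b c : V x -> dmx a G x b c = dmx a G x c b.
Proof. by move=> Vx; rewrite -[in LHS]dmx_metric_sym// mxE. Qed.

Lemma inv_sym x : V x -> (invmx (G x))^T = invmx (G x).
Proof. by move=> Vx; rewrite trmx_inv GT. Qed.

Lemma chr_lower a x : V x -> chr G a x *m G x = lowered G a x.
Proof. by move=> Vx; rewrite /chr mulmxKV// uG. Qed.

Lemma chr_sym a b c x : V x -> chr G a x b c = chr G b x a c.
Proof.
move=> Vx; rewrite mxE [RHS]mxE; apply: eq_bigr => e _; rewrite !loweredE.
by rewrite (dmx_metricC e a b)// [dmx a G x b e + _]addrC.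
Qed.

(** The metric is parallel: in the sum of [lowered G a x] and its transpose only
    the derivative along [a] survives. *)
Lemma chr_compat a x : V x ->
  dmx a G x = chr G a x *m G x + G x *m (chr G a x)^T.
Proof.
move=> Vx; have -> : G x *m (chr G a x)^T = (chr G a x *m G x)^T.
  by rewrite [RHS]trmx_mul GT.
rewrite chr_lower//; apply/matrixP => b c; rewrite addmxE [X in _ + X]mxE !loweredE.
rewrite (dmx_metricC a c b)//.
move: (dmx a G x b c) (dmx b G x a c) (dmx c G x a b) => p q r.
by field.
Qed.

(** Uniqueness of the Levi-Civita connection: the Koszul formula recovers a
    torsion-free connection that preserves the metric. *)
Lemma chr_unique (A : 'I_d -> Mat) x : V x ->
  (forall a b c, A a b c = A b a c) ->
  (forall a, dmx a G x = A a *m G x + G x *m (A a)^T) ->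
  forall a, A a = chr G a x.
Proof.
move=> Vx AC AG a; suff E1 : A a *m G x = lowered G a x.
  by rewrite /chr -E1 mulmxK// uG.
(* The lowered symbols L_abc, symmetric in a and b. *)
pose L b := A b *m G x.
have LC e b c : L e b c = L b e c.
  by rewrite /L !mxE; apply: eq_bigr => f _; rewrite AC.
have dGE e b c : dmx e G x b c = L e b c + L e c b.
  have -> : dmx e G x = L e + (L e)^T by rewrite AG /L trmx_mul GT.
  by rewrite addmxE [X in _ + X]mxE.
apply/matrixP => b c; rewrite loweredE !dGE -/(L a) (LC c a b) (LC c b a) (LC b a c).
by move: (L a b c) (L a c b) (L b c a) => p q r; field.
Qed.

Lemma chr_mdiff a x : V x -> mdiff (chr G a) x.
Proof. by move=> Vx; exact: msmooth_mdiff (msmooth_chr a) Vx. Qed.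

Lemma metric_mdiff x : V x -> mdiff G x.
Proof. by move=> Vx; exact: msmooth_mdiff sG Vx. Qed.

(** The curvature is skew with respect to the metric: apply the commutator of
    two second derivatives to the metric, which is parallel. *)
Lemma curv_antisym a b x : V x ->
  curv (chr G) a b x *m G x + G x *m (curv (chr G) a b x)^T = 0.
Proof.
move=> Vx; have dA := chr_mdiff _ Vx; have dG := metric_mdiff Vx.
have H e f : dmx e (dmx f G) x = dmx e (chr G f) x *m G x + chr G f x *m dmx e G x
    + (dmx e G x *m (chr G f x)^T + G x *m (dmx e (chr G f) x)^T).
  rewrite -dmx_tr -dmxM; [|exact: dA|exact: dG].
  rewrite -dmxM; [|exact: dG|by apply: mdiff_tr; exact: dA].
  rewrite -dmxD; first by apply: dmx_near oV Vx _ => y Vy; exact: chr_compat.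
    by apply: mdiffM; [exact: dA|exact: dG].
  by apply: mdiffM; [exact: dG|apply: mdiff_tr; exact: dA].
have := H a b; rewrite (dmx_comm a b oV sG Vx) H => /eqP; rewrite -subr_eq0 => /eqP.
rewrite !(chr_compat _ Vx) /curv => HH.
rewrite -[RHS]oppr0 -[in RHS]HH.
gen_atoms x; mxring.
Qed.

Lemma dmx_inv a x : V x -> dmx a (fun y => invmx (G y)) x =
  - (invmx (G x) *m chr G a x + (chr G a x)^T *m invmx (G x)).
Proof.
move=> Vx; have dG := metric_mdiff Vx.
have dI := msmooth_mdiff msmooth_inv Vx.
have : dmx a (fun y => invmx (G y) *m G y) x = 0.
  have -> : dmx a (fun y => invmx (G y) *m G y) x = dmx a (fun=> 1%:M) x.
    by apply: dmx_near oV Vx _ => y Vy; rewrite mulVmx ?uG.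
  by apply/matrixP => i j; rewrite dmxE [RHS]mxE; exact: derive_cst.
rewrite dmxM// chr_compat// => /eqP; rewrite addr_eq0 => /eqP H.
rewrite -[LHS](mulmxK (uG Vx)) H mulNmx mulmxDr mulmxDl !mulmxA.
by rewrite mulVmx ?uG// mul1mx mulmxK ?uG.
Qed.

End AtMetric.
End Metric.

(** * Bianchi identities *)

Section Curvature.
Context {R : realType} {d : nat}.
Implicit Types (V : set 'rV[R]_d) (x y : 'rV[R]_d) (a b c e f : 'I_d).
Local Notation E := 'rV[R]_d.
Local Notation Mat := 'M[R]_d.

Lemma curvE (A : 'I_d -> E -> Mat) a b x e c : curv A a b x e c =
  dmx a (A b) x e c - dmx b (A a) x e c + (A b x *m A a x) e c
    - (A a x *m A b x) e c.
Proof. by rewrite /curv !(addmxE, oppmxE). Qed.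

Lemma ricE (A : 'I_d -> E -> Mat) x a b : ric A x a b = \sum_c curv A c a x b c.
Proof. by rewrite mxE. Qed.

(** First Bianchi identity: by the symmetry of [A] every term of the cyclic sum
    occurs twice, with opposite signs. *)
Lemma bianchi1 V (A : 'I_d -> E -> Mat) a b e c x : open V -> V x ->
  (forall y a b c, V y -> A a y b c = A b y a c) ->
  curv A a b x e c + curv A b e x a c + curv A e a x b c = 0.
Proof.
move=> oV Vx AC.
have dAC f g h : dmx f (A g) x h c = dmx f (A h) x g c.
  by rewrite !dmxE; apply: derive_near oV Vx _ => y Vy; rewrite AC.
have AAC f g h : (A g x *m A f x) h c = (A h x *m A f x) g c.
  by rewrite mxE [RHS]mxE; apply: eq_bigr => k _; rewrite (AC _ g h k).
rewrite !curvE (dAC a b e) (dAC b a e) (dAC e b a) (AAC a b e) (AAC b a e) (AAC e b a).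
move: (dmx _ _ _ _ _) (dmx b _ _ _ _) (dmx e _ _ _ _) => p q r.
move: (_ *m _) (A e x *m A b x) (A a x *m A e x) => s t w.
ring.
Qed.

(** The algebra behind the contracted Bianchi identity. [K a b] stands for the
    curvature with its last two indices raised, [dK] for its partial derivatives
    and [Ga] for the Christoffel symbols. Contracting the cyclic identity over
    both pairs of indices gives one term with the gradient of the scalar and two
    equal terms with the divergence of the Ricci tensor; the terms that contract
    a pair of lower indices of [Ga] with a skew pair of [K] vanish. *)
Lemma bianchi_contraction (K : 'I_d -> 'I_d -> Mat)
    (dK : 'I_d -> 'I_d -> 'I_d -> Mat) (Ga : 'I_d -> Mat) c :
  (forall a b, K a b = - K b a) -> (forall a b, (K a b)^T = - K a b) ->
  (forall c a b, dK c a b = - dK c b a) ->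
  (forall c a b, (dK c a b)^T = - dK c a b) ->
  (forall a b c, Ga a b c = Ga b a c) ->
  (forall c a b, let D c a b := dK c a b + (Ga c)^T *m K a b + K a b *m Ga c in
     D c a b + D a b c + D b c a = 0) ->
  let rho b e := \sum_a K a b e a in
  let drho c b e := \sum_a dK c a b e a in
  \sum_b drho c b b =
    2 * \sum_b (drho b c b + (\sum_f rho c f * Ga b f b)
                - (\sum_f Ga b c f * rho f b)).
Proof.
move=> KC KT dKC dKT GC cyc rho drho.
have KTE a b e f : K a b e f = - K a b f e.
  by have /matrixP/(_ f e) := KT a b; rewrite mxE oppmxE.
have dKTE g a b e f : dK g a b e f = - dK g a b f e.
  by have /matrixP/(_ f e) := dKT g a b; rewrite mxE oppmxE.
have KCE a b e f : K a b e f = - K b a e f by rewrite KC oppmxE.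
have dKCE g a b e f : dK g a b e f = - dK g b a e f by rewrite dKC oppmxE.
pose T g a b e f := dK g a b e f + (\sum_h Ga g h e * K a b h f)
   + (\sum_h K a b e h * Ga g h f).
have cycE a b : T c a b b a + T a b c b a + T b c a b a = 0.
  have /matrixP/(_ b a) := cyc c a b; rewrite zeromxE !addmxE => <-.
  congr (_ + _ + _); rewrite /T; congr (_ + _ + _); rewrite mxE //.
  - by apply: eq_bigr => h _; rewrite mxE.
  - by apply: eq_bigr => h _; rewrite mxE.
  - by apply: eq_bigr => h _; rewrite mxE.
(* The third term of the cyclic identity is the second one with a and b swapped. *)
have T32 a b : T b c a b a = T b a c a b.
  rewrite /T dKTE dKCE opprK -addrA [X in _ + X]addrC addrA; congr (_ + _ + _).
    by apply: eq_bigr => h _; rewrite KTE KCE opprK mulrC.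
  by apply: eq_bigr => h _; rewrite KTE KCE opprK mulrC.
(* Symmetric in (a, h) against antisymmetric in (h, a). *)
have Z : \sum_a \sum_b \sum_h Ga a h b * K b c h a = 0.
  rewrite exchange_big big1// => b _ /=; set S := LHS.
  have SN : S = - S.
    rewrite {1}/S exchange_big /S -sumrN; apply: eq_bigr => a _ /=.
    by rewrite -sumrN; apply: eq_bigr => h _; rewrite KTE GC mulrN.
  have /eqP : S + S = 0 by rewrite {1}SN addNr.
  by rewrite -mulr2n mulrn_eq0 => /eqP.
have sum2 : \sum_a \sum_b T a b c b a =
    - \sum_b (drho b c b + (\sum_f rho c f * Ga b f b)).
  transitivity (\sum_a (- drho a c a - \sum_f rho c f * Ga a f a)
                + \sum_a \sum_b \sum_h Ga a h b * K b c h a); last first.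
    by rewrite Z addr0 -sumrN; apply: eq_bigr => a _; rewrite opprD.
  rewrite -big_split; apply: eq_bigr => a _ /=; rewrite /T !big_split /= addrAC.
  congr (_ + _ + _).
    by rewrite /drho -sumrN; apply: eq_bigr => b _; rewrite dKTE.
  rewrite exchange_big -sumrN; apply: eq_bigr => h _ /=.
  rewrite /rho !mulr_suml -sumrN; apply: eq_bigr => b _.
  by rewrite KTE mulNr.
have sum1 : \sum_a \sum_b T c a b b a =
    \sum_b drho c b b + 2 * \sum_b \sum_f Ga b c f * rho f b.
  have -> : \sum_b drho c b b = \sum_a \sum_b dK c a b b a.
    by rewrite [RHS]exchange_big.
  have E1 : \sum_b \sum_f Ga b c f * rho f b =
      \sum_a \sum_b \sum_h Ga c h b * K a b h a.
    rewrite [RHS]exchange_big [LHS]exchange_big; apply: eq_bigr => b _ /=.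
    rewrite [RHS]exchange_big; apply: eq_bigr => h _ /=.
    by rewrite /rho mulr_sumr; apply: eq_bigr => a _; rewrite GC.
  have E2 : \sum_b \sum_f Ga b c f * rho f b =
      \sum_a \sum_b \sum_h K a b b h * Ga c h a.
    rewrite [LHS]exchange_big; apply: eq_bigr => a _ /=.
    rewrite [RHS]exchange_big; apply: eq_bigr => h _ /=.
    rewrite /rho mulr_sumr; apply: eq_bigr => b _.
    by rewrite GC mulrC KTE KCE opprK.
  rewrite mulrDl mul1r {1}E1 E2 addrA -!big_split; apply: eq_bigr => a _ /=.
  by rewrite -!big_split; apply: eq_bigr.
have : \sum_a \sum_b (T c a b b a + T a b c b a + T b c a b a) = 0.
  by rewrite big1// => a _; rewrite big1.
have sum3 : \sum_a \sum_b T b c a b a = \sum_a \sum_b T a b c b a.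
  by rewrite exchange_big; apply: eq_bigr => a _; apply: eq_bigr => b _; rewrite T32.
have -> : \sum_a \sum_b (T c a b b a + T a b c b a + T b c a b a) =
    \sum_a \sum_b T c a b b a + \sum_a \sum_b T a b c b a
    + \sum_a \sum_b T b c a b a.
  by rewrite -!big_split; apply: eq_bigr => a _; rewrite -!big_split.
rewrite sum3 sum1 sum2 sumrB.
move: (\sum_b _) (\sum_b _) (\sum_b _) => p q r H.
by apply/eqP; rewrite -subr_eq0 -[X in _ == X]H; apply/eqP; ring.
Qed.

End Curvature.

Section RicciMetric.
Context {R : realType} {d : nat}.
Implicit Types (V : set 'rV[R]_d) (x y : 'rV[R]_d) (a b c e f : 'I_d).
Local Notation E := 'rV[R]_d.
Local Notation Mat := 'M[R]_d.

Context {V : set E} {G : E -> Mat} (mG : semi_riemannian V G).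
Let oV : open V. Proof. by case: mG. Qed.
Let sG : msmooth V G. Proof. by case: mG. Qed.
Let GT x : V x -> (G x)^T = G x. Proof. by case: mG => _ _ h _; exact: h. Qed.
Let uG x : V x -> G x \in unitmx. Proof. by case: mG => _ _ _; exact. Qed.
Local Notation A := (chr G).

(** Raising an index turns skewness with respect to the metric into
    antisymmetry of the matrix, so that contractions need no metric. *)
Definition curv_up a b y : Mat := invmx (G y) *m curv A a b y.

Definition mixed (T : E -> Mat) y : Mat := T y *m invmx (G y).

Definition scal y : R := \tr (mixed (ric A) y).

Lemma curv_upT a b x : V x -> (curv_up a b x)^T = - curv_up a b x.
Proof.
move=> Vx; have /eqP := curv_antisym mG a b Vx.
rewrite addr_eq0 => /eqP H; have uGx := uG Vx.
apply/eqP; rewrite -[_ == _]eqr_oppLR -/(curv_up _ _ _); apply/eqP.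
rewrite /curv_up -[in RHS](mulmxK uGx (curv A a b x)) H.
by rewrite trmx_mul (inv_sym mG)// mulNmx mulmxN !mulmxA mulVmx// mul1mx.
Qed.

(** Contract the first Bianchi identity; the trace of the curvature
    endomorphism vanishes, since this endomorphism is skew. *)
Lemma ric_sym a b x : V x -> ric A x a b = ric A x b a.
Proof.
move=> Vx; have AC y e f g : V y -> A e y f g = A f y e g by exact: chr_sym.
(* G times a skew matrix is traceless, G being symmetric. *)
have tr0 : \sum_c curv A a b x c c = 0.
  have -> : \sum_c curv A a b x c c = \tr (curv A a b x) by [].
  have uGx := uG Vx.
  have -> : curv A a b x = G x *m curv_up a b x by rewrite /curv_up mulKVmx.
  have : \tr (G x *m curv_up a b x) = - \tr (G x *m curv_up a b x).
    rewrite -{1}mxtrace_tr trmx_mul curv_upT// GT// mulNmx [\tr (- _)]linearN.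
    by rewrite mxtrace_mulC.
  set S := \tr _ => SN; have /eqP : S + S = 0 by rewrite {1}SN addNr.
  by rewrite -mulr2n mulrn_eq0 => /eqP.
apply/eqP; rewrite -subr_eq0 !ricE -sumrB; apply/eqP.
transitivity (- \sum_c curv A a b x c c); last by rewrite tr0 oppr0.
rewrite -sumrN; apply: eq_bigr => c _; have := bianchi1 c a b c oV Vx AC.
rewrite [curv A b c x]curvC oppmxE => /eqP.
by rewrite addrAC addr_eq0 => /eqP.
Qed.

Lemma msmooth_curv_up a b : msmooth V (curv_up a b).
Proof.
apply: msmoothM => //; first exact: msmooth_inv mG.
by apply: msmooth_curv => // c; exact: msmooth_chr mG _.
Qed.

Lemma dmx_curv_up c a b x : V x -> dmx c (curv_up a b) x =
  invmx (G x) *m (dmx c (curv A a b) x - A c x *m curv A a b x)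
  - (A c x)^T *m curv_up a b x.
Proof.
move=> Vx; rewrite /curv_up dmxM; last first.
- by apply: msmooth_mdiff Vx; apply: msmooth_curv => // e; exact: msmooth_chr mG _.
- by apply: msmooth_mdiff Vx; exact: msmooth_inv mG.
rewrite (dmx_inv mG)//.
by move: (dmx c _ x) (A c x) (curv A a b x) (invmx _) => *; mxring.
Qed.

Lemma mixed_ricE x e b : V x -> mixed (ric A) x b e = \sum_a curv_up a b x e a.
Proof.
move=> Vx; rewrite mxE; under [RHS]eq_bigr do rewrite mxE.
rewrite exchange_big; apply: eq_bigr => f _ /=.
rewrite ricE mulr_suml; apply: eq_bigr => a _.
by rewrite mulrC -[in LHS](inv_sym mG Vx) mxE.
Qed.

Lemma msmooth_mixed T : msmooth V T -> msmooth V (mixed T).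
Proof. by move=> sT; apply: msmoothM => //; exact: msmooth_inv mG. Qed.

Lemma msmooth_chrric : msmooth V (ric A).
Proof. by apply: msmooth_ric => // a; exact: msmooth_chr mG _. Qed.

(** nabla_c t_a^c for a tensor [t] with one lower and one upper index. *)
Definition mixed_div (t : E -> Mat) x a : R :=
  \sum_c (dmx c t x + t x *m A c x - A c x *m t x) a c.

(** Since the metric is parallel, the second index may be raised before
    differentiating. *)
Lemma divergenceE (T : E -> Mat) x a : V x -> mdiff T x ->
  \sum_b \sum_c invmx (G x) b c * (dmx c T x a b
     - \sum_e A c x a e * T x e b - \sum_e A c x b e * T x a e)
  = mixed_div (mixed T) x a.
Proof.
move=> Vx dT; rewrite exchange_big; apply: eq_bigr => c _ /=.
have -> : \sum_b invmx (G x) b c * (dmx c T x a b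
     - \sum_e A c x a e * T x e b - \sum_e A c x b e * T x a e) =
   ((dmx c T x - A c x *m T x - T x *m (A c x)^T) *m invmx (G x)) a c.
  rewrite [RHS]mxE; apply: eq_bigr => b _; rewrite mulrC !addmxE !oppmxE.
  congr ((_ - _ - _) * _); rewrite [RHS]mxE //.
  by apply: eq_bigr => e _; rewrite [in RHS]mxE mulrC.
rewrite /mixed dmxM//; last by apply: msmooth_mdiff Vx; exact: msmooth_inv mG.
rewrite (dmx_inv mG)//; congr (fun_of_matrix _ a c).
by move: (dmx c _ x) (A c x) (T x) (invmx _) => *; mxring.
Qed.

Lemma mixed_divE (t : E -> Mat) (K : 'I_d -> 'I_d -> Mat)
    (dK : 'I_d -> 'I_d -> 'I_d -> Mat) x c :
  (forall e b f, dmx e t x b f = \sum_a dK e a b f a) ->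
  (forall b f, t x b f = \sum_a K a b f a) ->
  mixed_div t x c = \sum_b (\sum_a dK b a c b a
    + (\sum_f (\sum_a K a c f a) * A b x f b)
    - (\sum_f A b x c f * (\sum_a K a f b a))).
Proof.
move=> dtE tE; apply: eq_bigr => b _; rewrite !addmxE oppmxE dtE.
move: (A b x) => Ab; congr (_ + _ - _); rewrite mxE.
  by apply: eq_bigr => f _; rewrite tE.
by apply: eq_bigr => f _; rewrite tE.
Qed.

(** [bianchi_contraction] applied to the curvature with raised indices: there, the
    derivative of the inverse metric supplies the Christoffel symbols that turn
    [bianchi2] into a cyclic identity for [curv_up]. *)
Lemma contracted_bianchi c x : V x ->
  'D_('e_c) scal x = 2 * mixed_div (mixed (ric A)) x c.
Proof.
move=> Vx; have sK a b := msmooth_curv_up a b.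
have dK a b : mdiff (curv_up a b) x := msmooth_mdiff (sK a b) Vx.
have dmixE e b f : dmx e (mixed (ric A)) x b f = \sum_a dmx e (curv_up a b) x f a.
  rewrite dmxE; under [RHS]eq_bigr do rewrite dmxE.
  rewrite -derive_fsum; last by move=> a; exact: dK.
  by apply: derive_near oV Vx _ => y Vy; rewrite mixed_ricE.
have -> : 'D_('e_c) scal x = \sum_b dmx c (mixed (ric A)) x b b.
  under [RHS]eq_bigr do rewrite dmxE.
  rewrite -derive_fsum// => b.
  by have := msmooth_mdiff (msmooth_mixed msmooth_chrric) Vx; exact.
under eq_bigr do rewrite dmixE.
rewrite (@bianchi_contraction _ _ (fun a b => curv_up a b x)
   (fun c a b => dmx c (curv_up a b) x) (fun a => A a x)).
- congr (_ * _); apply/esym.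
  apply: (@mixed_divE _ (fun a b => curv_up a b x)
    (fun c a b => dmx c (curv_up a b) x)) => // b f; exact: mixed_ricE.
- by move=> a b; rewrite /curv_up curvC mulmxN.
- by move=> a b; exact: curv_upT.
- move=> e a b; apply/matrixP => i j; rewrite oppmxE !dmxE -deriveN; last first.
    by apply: diff_derivable; exact: dK.
  apply: derive_near oV Vx _ => y Vy.
  by rewrite /curv_up curvC mulmxN oppmxE.
- move=> e a b; apply/matrixP => i j; rewrite mxE oppmxE !dmxE -deriveN; last first.
    by apply: diff_derivable; exact: dK.
  apply: derive_near oV Vx _ => y Vy.
  have /matrixP/(_ i j) := curv_upT a b Vy.
  by rewrite mxE oppmxE.
- by move=> a b e; exact: (chr_sym mG).
move=> e a b /=; rewrite !dmx_curv_up//.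
have sA i : msmooth V (A i) := msmooth_chr mG i.
have B2 := bianchi2 e a b oV sA Vx.
rewrite -[RHS](mulmx0 _ (invmx (G x))) -[in RHS]B2 /curv_up.
gen_atoms x; move: (invmx _) => *; mxring.
Qed.

End RicciMetric.
Arguments curv_up {R d} G a b y.
Arguments mixed {R d} G T y.
Arguments scal {R d} G y.
Arguments mixed_div {R d} G t x a.

(** * Conformal change of the connection *)

Lemma sum_delta_l (R : pzRingType) d (b : 'I_d) (F : 'I_d -> R) :
  \sum_c (b == c)%:R * F c = F b.
Proof.
rewrite (bigD1 b)//= eqxx mul1r big1 ?addr0// => c /negbTE.
by rewrite eq_sym => ->; rewrite mul0r.
Qed.

Section Conformal.
Context {R : realType} {d : nat}.
Implicit Types (V : set 'rV[R]_d) (x y : 'rV[R]_d) (a b c e f : 'I_d).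
Local Notation E := 'rV[R]_d.
Local Notation Mat := 'M[R]_d.

Context {V : set E} {G H : E -> Mat} {u : E -> R}.
Context (mG : semi_riemannian V G) (su : Csmooth V u).
Context (u0 : forall x, V x -> u x != 0).
Context (HE : forall x, V x -> H x = (u x) ^- 2 *: G x).
Let oV : open V. Proof. by case: mG. Qed.
Let sG : msmooth V G. Proof. by case: mG. Qed.
Let GT x : V x -> (G x)^T = G x. Proof. by case: mG => _ _ h _; exact: h. Qed.
Let uG x : V x -> G x \in unitmx. Proof. by case: mG => _ _ _; exact. Qed.

(** The 1-form Upsilon = - du / u, half the logarithmic derivative of u^-2. *)
Definition ups b y : R := - ('D_('e_b) u y / u y).

Definition ups_up c y : R := \sum_e invmx (G y) c e * ups e y.

(** The difference of the Levi-Civita connections of [u^-2 G] and [G]: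
    [Upsilon_a delta_b^c + Upsilon_b delta_a^c - G_ab Upsilon^c]. *)
Definition conf a y : Mat := \matrix_(b, c)
  (ups a y * (b == c)%:R + ups b y * (a == c)%:R - G y a b * ups_up c y).

Lemma confE a y b c : conf a y b c =
  ups a y * (b == c)%:R + ups b y * (a == c)%:R - G y a b * ups_up c y.
Proof. by rewrite mxE. Qed.

Lemma semi_riemannian_rescaled : semi_riemannian V H.
Proof.
have [_ _ _ _] := mG; split=> //.
- move=> i j; apply: (@Csmooth_ext _ _ _ (fun y => (u y) ^- 2 * G y i j)) => //.
    by move=> y Vy; rewrite HE// mxE.
  apply: CsmoothM => //; apply: CsmoothV => //; last exact: CsmoothX.
  by move=> y Vy; rewrite expf_neq0// u0.
- by move=> x Vx; rewrite HE// linearZ /= GT.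
- by move=> x Vx; rewrite HE// unitmxZ ?uG// unitfE invr_eq0 expf_neq0// u0.
Qed.

Lemma Csmooth_ups b : Csmooth V (ups b).
Proof.
apply: CsmoothN => //; apply: CsmoothM => //; first exact: Csmooth_derive.
exact: CsmoothV.
Qed.

Lemma Csmooth_ups_up c : Csmooth V (ups_up c).
Proof.
apply: Csmooth_sum => // e _; apply: CsmoothM => //; last exact: Csmooth_ups.
exact: (msmooth_inv mG).
Qed.

Lemma msmooth_conf a : msmooth V (conf a).
Proof.
move=> b c; have -> : (fun y => conf a y b c) = (fun y =>
  ups a y * (b == c)%:R + ups b y * (a == c)%:R - G y a b * ups_up c y).
  by apply: funext => y; rewrite confE.
apply: CsmoothB => //.
  by apply: CsmoothD => //; apply: CsmoothM => //;
    [exact: Csmooth_ups|exact: Csmooth_cst|exact: Csmooth_ups|exact: Csmooth_cst].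
by apply: CsmoothM => //; exact: Csmooth_ups_up.
Qed.

Lemma ups_lower x a : V x -> \sum_c G x a c * ups_up c x = ups a x.
Proof.
move=> Vx; under eq_bigr do rewrite mulr_sumr.
rewrite exchange_big /=.
transitivity (\sum_e (a == e)%:R * ups e x); last exact: sum_delta_l.
apply: eq_bigr => e _; under eq_bigr do rewrite mulrA.
rewrite -mulr_suml; congr (_ * _).
by have /matrixP/(_ a e) := mulmxV (uG Vx); rewrite !mxE.
Qed.

Lemma ups_lower' x a : V x -> \sum_c G x c a * ups_up c x = ups a x.
Proof.
move=> Vx; rewrite -(ups_lower a Vx); apply: eq_bigr => c _.
by rewrite -[in LHS](GT Vx) mxE.
Qed.

Lemma conf_lower a b c x : V x -> (conf a x *m G x) b c =
  ups a x * G x b c + ups b x * G x a c - G x a b * ups c x.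
Proof.
move=> Vx; rewrite mxE.
transitivity (ups a x * (\sum_e (b == e)%:R * G x e c)
  + ups b x * (\sum_e (a == e)%:R * G x e c)
  - G x a b * (\sum_e G x e c * ups_up e x)); last first.
  by rewrite !sum_delta_l ups_lower'.
rewrite !mulr_sumr -sumrN -!big_split /=; apply: eq_bigr => e _; rewrite confE.
move: (b == e)%:R (a == e)%:R (ups a x) (ups b x) (ups_up e x) => p q r t w.
by move: (G x a b) (G x e c) => *; ring.
Qed.

Lemma derive_weight x a : V x ->
  'D_('e_a) (fun y => (u y) ^- 2) x = 2 * ups a x * (u x) ^- 2.
Proof.
move=> Vx; have du := Csmooth_differentiable su Vx.
have -> : (fun y => (u y) ^- 2) = (fun y => (u y * u y)^-1).
  by apply: funext => y; rewrite expr2.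
have d2 : differentiable (fun y => u y * u y) x by exact: differentiableM.
rewrite derive_fV//; last by rewrite mulf_neq0 ?u0.
rewrite derive_fM// /ups; have := u0 Vx; move: (u x) ('D_ _ _ _) => p q p0.
by field.
Qed.

Lemma chr_conf a x : V x -> chr H a x = chr G a x + conf a x.
Proof.
move=> Vx; have dG := metric_mdiff mG Vx.
have dH e b c : dmx e H x b c =
    (u x) ^- 2 * (2 * ups e x * G x b c + dmx e G x b c).
  rewrite !dmxE.
  have -> : 'D_('e_e) (fun y => H y b c) x =
      'D_('e_e) (fun y => (u y) ^- 2 * G y b c) x.
    by apply: derive_near oV Vx _ => y Vy; rewrite HE// mxE.
  rewrite derive_fM//; last first.
    apply: Csmooth_differentiable Vx; apply: CsmoothV => //; last exact: CsmoothX.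
    by move=> y Vy; rewrite expf_neq0// u0.
  by rewrite derive_weight//; ring.
have u2 : (u x) ^- 2 \is a GRing.unit by rewrite unitfE invr_eq0 expf_neq0// u0.
have lowE : lowered H a x = (u x) ^- 2 *: (lowered G a x + conf a x *m G x).
  apply/matrixP => b c; rewrite loweredE [RHS]mxE addmxE loweredE conf_lower//.
  rewrite (dH a b c) (dH b a c) (dH c a b).
  move: (dmx a G x b c) (dmx b G x a c) (dmx c G x a b) => p q r.
  move: (ups a x) (ups b x) (ups c x) (G x _ _) (G x _ _) (G x _ _) ((u x)^-2) => *.
  by field.
rewrite /chr lowE HE// invmxZ//; last by rewrite unitmxZ ?uG.
rewrite -scalemxAl -scalemxAr scalerA mulfV ?scale1r -?unitfE//.
by rewrite mulmxDl mulmxK ?uG.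
Qed.

End Conformal.
Arguments ups {R d} u b y.
Arguments ups_up {R d} G u c y.
Arguments conf {R d} G u a y.

(** * Contractions of the conformal difference tensor *)

Section ConformalAlgebra.
Context {R : comPzRingType} {d : nat}.
Implicit Types (a b c e f : 'I_d).
Local Notation Mat := 'M[R]_d.
Context (Y U : 'I_d -> R) (g : Mat) (A C : 'I_d -> Mat).
Context (gU : forall a, \sum_c g a c * U c = Y a) (gT : g^T = g).
Context (AC : forall a b c, A a b c = A b a c).
Context (CE : forall a b c, C a b c =
  Y a * (b == c)%:R + Y b * (a == c)%:R - g a b * U c).

Let gC a b : g a b = g b a. Proof. by rewrite -[in LHS]gT mxE. Qed.

Let gU' a : \sum_c g c a * U c = Y a.
Proof. by rewrite -(gU a); apply: eq_bigr => c _; rewrite gC. Qed.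

Lemma conf_vec a b (v : 'I_d -> R) : \sum_f C a b f * v f =
  Y a * v b + Y b * v a - g a b * (\sum_f U f * v f).
Proof.
transitivity (Y a * (\sum_f (b == f)%:R * v f) + Y b * (\sum_f (a == f)%:R * v f)
   - g a b * (\sum_f U f * v f)); last by rewrite !sum_delta_l.
rewrite !mulr_sumr -sumrN -!big_split /=; apply: eq_bigr => f _; rewrite CE.
by move: (_ == _)%:R (a == f)%:R => p q; ring.
Qed.

Lemma conf_trace a : \sum_c C c a c = d%:R * Y a.
Proof.
transitivity (\sum_c (a == c)%:R * Y c + \sum_(c < d) Y a - \sum_c g c a * U c).
  rewrite -sumrN -!big_split; apply: eq_bigr => c _; rewrite CE eqxx /=.
  by move: (_ == _)%:R => p; ring.
by rewrite sum_delta_l gU' sumr_const card_ord -mulr_natl; ring.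
Qed.

Lemma conf_symm a b c : C a b c = C b a c.
Proof. by rewrite !CE gC [X in X - _]addrC. Qed.

Lemma conf_trace' a : \sum_c C a c c = d%:R * Y a.
Proof. by rewrite -conf_trace; apply: eq_bigr => c _; rewrite conf_symm. Qed.

Lemma conf_mul_lower a b c :
  (C a *m g) b c = Y a * g b c + Y b * g a c - g a b * Y c.
Proof.
rewrite mxE (conf_vec a b (fun f => g f c)); congr (_ - _ * _).
by rewrite -(gU' c); apply: eq_bigr => f _; rewrite mulrC.
Qed.

Lemma conf_contr_l b (X : Mat) : \sum_c (C c *m X) b c =
  \sum_c Y c * X b c + Y b * \tr X - \sum_f U f * (X *m g) f b.
Proof.
transitivity (\sum_c (Y c * X b c + Y b * X c c - g c b * \sum_f U f * X f c)).
  by apply: eq_bigr => c _; rewrite mxE (conf_vec c b (fun f => X f c)).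
rewrite big_split sumrN big_split /= -mulr_sumr; congr (_ + _ - _).
under eq_bigr do rewrite mulr_sumr.
rewrite exchange_big; apply: eq_bigr => f _ /=; rewrite mxE mulr_sumr.
by apply: eq_bigr => c _; ring.
Qed.

Lemma conf_contr_r a b : \sum_c (A c *m C a) b c =
  Y a * (\sum_c A c b c) + \sum_f A a b f * Y f - \sum_c U c * (A c *m g) b a.
Proof.
transitivity (\sum_c (Y a * A c b c
    + (a == c)%:R * (\sum_f A c b f * Y f) - U c * \sum_f A c b f * g f a)).
  apply: eq_bigr => c _; rewrite mxE.
  transitivity (Y a * (\sum_f (c == f)%:R * A c b f)
    + (a == c)%:R * (\sum_f A c b f * Y f) - U c * \sum_f A c b f * g f a).
    rewrite !mulr_sumr -sumrN -!big_split /=; apply: eq_bigr => f _.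
    by rewrite CE (gC f a) (eq_sym c f); move: (_ == _)%:R (a == c)%:R => p q; ring.
  by rewrite sum_delta_l.
rewrite big_split sumrN big_split /= -mulr_sumr sum_delta_l; congr (_ + _ - _).
by apply: eq_bigr => c _; rewrite [in RHS]mxE.
Qed.

(** The terms without derivatives of Upsilon in the change of the Ricci tensor.
    The Christoffel symbols [A] combine so that the final formula contains only
    the covariant derivative of Upsilon and the derivative of the metric. *)
Lemma ric_conf_algebra a b :
  \sum_c (C a *m A c + A a *m C c - C c *m A a - A c *m C a
          + C a *m C c - C c *m C a) b c =
  (d%:R - 2) * (\sum_f A a b f * Y f + Y a * Y b)
  - g a b * (\sum_f U f * (\sum_c A c f c) + (d%:R - 2) * \sum_f U f * Y f)
  + \sum_f U f * (A f *m g + (A f *m g)^T) a b.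
Proof.
have tA e : \tr (A e) = \sum_c A c e c.
  by apply: eq_bigr => c _; rewrite AC.
have S3 : \sum_c (C a *m A c) b c = Y a * (\sum_c A c b c) + Y b * (\sum_c A c a c)
    - g a b * \sum_f U f * (\sum_c A c f c).
  rewrite -(conf_vec a b (fun f => \sum_c A c f c)).
  under eq_bigr do rewrite mxE.
  by rewrite exchange_big; apply: eq_bigr => f _; rewrite mulr_sumr.
have S4 : \sum_c (A a *m C c) b c = d%:R * \sum_f A a b f * Y f.
  under eq_bigr do rewrite mxE.
  rewrite exchange_big mulr_sumr; apply: eq_bigr => f _ /=.
  by rewrite -mulr_sumr conf_trace; ring.
have S7 : \sum_c (C a *m C c) b c =
    d%:R * (Y a * Y b + Y b * Y a - g a b * \sum_f U f * Y f).
  rewrite -(conf_vec a b Y); under eq_bigr do rewrite mxE.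
  rewrite exchange_big mulr_sumr; apply: eq_bigr => f _ /=.
  by rewrite -mulr_sumr conf_trace; ring.
have S8 : \sum_c (C c *m C a) b c = (d%:R + 2) * (Y a * Y b)
    - 2 * g a b * \sum_f U f * Y f.
  rewrite conf_contr_l [\tr _]conf_trace'.
  have -> : \sum_c Y c * C a b c = Y a * Y b + Y b * Y a - g a b * \sum_f U f * Y f.
    by rewrite -(conf_vec a b Y); apply: eq_bigr => c _; rewrite mulrC.
  have -> : \sum_f U f * (C a *m g) f b =
      Y a * Y b + g a b * (\sum_f U f * Y f) - Y b * Y a.
    transitivity (Y a * (\sum_f g f b * U f) + g a b * (\sum_f U f * Y f)
      - Y b * (\sum_f g a f * U f)); last by rewrite gU gU'.
    rewrite !mulr_sumr -sumrN -!big_split; apply: eq_bigr => f _ /=.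
    by rewrite conf_mul_lower; ring.
  by ring.
have S56 : \sum_f U f * (A f *m g + (A f *m g)^T) a b =
    \sum_f U f * (A a *m g) f b + \sum_f U f * (A f *m g) b a.
  rewrite -big_split; apply: eq_bigr => f _ /=; rewrite addmxE [X in _ + X]mxE mulrDr.
  congr (_ * _ + _); rewrite mxE [RHS]mxE; apply: eq_bigr => h _.
  by rewrite AC.
have -> : \sum_c (C a *m A c + A a *m C c - C c *m A a - A c *m C a
          + C a *m C c - C c *m C a) b c =
    \sum_c (C a *m A c) b c + \sum_c (A a *m C c) b c - \sum_c (C c *m A a) b c
    - \sum_c (A c *m C a) b c + \sum_c (C a *m C c) b c - \sum_c (C c *m C a) b c.
  rewrite -!sumrN -!big_split; apply: eq_bigr => c _ /=.
  by rewrite !(addmxE, oppmxE).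
rewrite S3 S4 S7 S8 S56 conf_contr_l conf_contr_r tA.
have -> : \sum_c Y c * A a b c = \sum_f A a b f * Y f.
  by apply: eq_bigr => c _; rewrite mulrC.
by ring.
Qed.

End ConformalAlgebra.

(** * Conformal change of the Ricci tensor *)

Lemma conf_deriv_contr (R : comPzRingType) d (U : 'I_d -> R) (dY dU : 'I_d -> 'I_d -> R)
    (g : 'M[R]_d) (dg : 'I_d -> 'M[R]_d) a b :
  \sum_c (dY c a * (b == c)%:R + dY c b * (a == c)%:R
          - (dg c a b * U c + g a b * dU c c))
  = dY b a + dY a b - \sum_c dg c a b * U c - g a b * \sum_c dU c c.
Proof.
rewrite -(sum_delta_l b (fun c => dY c a)) -(sum_delta_l a (fun c => dY c b)).
rewrite mulr_sumr -!sumrN -!big_split; apply: eq_bigr => c _ /=.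
by move: (_ == _)%:R (a == c)%:R => p q; ring.
Qed.

(** The final bookkeeping of [ric_conf]: [D] stands for a second derivative of
    [u], [DU] + [UT] for the divergence of Upsilon, [UY] for its squared norm, and
    [S] for the derivative of the metric along Upsilon, which drops out. *)
Lemma ric_conf_arith (F : fieldType) (N w D AY YY g DU UT UY S X : F) : w != 0 ->
  X + (- (D / w) + YY + (- (D / w) + YY) - S - g * DU) - N * (- (D / w) + YY)
    + ((N - 2) * (AY + YY) - g * (UT + (N - 2) * UY) + S)
  = X + (N - 2) / w * (D + w * AY) + - (DU + UT + (N - 2) * UY) * g.
Proof. by move=> w0; field. Qed.

Lemma ric_conf_coef_arith (F : fieldType) (N w D t q : F) : w != 0 ->
  w^-1 * (D + t) - (N - 1) * w ^- 2 * q
  = - (- (D / w) + q / w ^+ 2 + - t / w + (N - 2) * (q / w ^+ 2)).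
Proof. by move=> w0; field. Qed.

Section ConformalRicci.
Context {R : realType} {d : nat}.
Implicit Types (V : set 'rV[R]_d) (x y : 'rV[R]_d) (a b c e f : 'I_d).
Local Notation E := 'rV[R]_d.
Local Notation Mat := 'M[R]_d.

Context {V : set E} {G H : E -> Mat} {u : E -> R}.
Context (mG : semi_riemannian V G) (su : Csmooth V u).
Context (u0 : forall x, V x -> u x != 0).
Context (HE : forall x, V x -> H x = (u x) ^- 2 *: G x).
Let oV : open V. Proof. by case: mG. Qed.
Let sG : msmooth V G. Proof. by case: mG. Qed.
Let GT x : V x -> (G x)^T = G x. Proof. by case: mG => _ _ h _; exact: h. Qed.
Let uG x : V x -> G x \in unitmx. Proof. by case: mG => _ _ _; exact. Qed.
Local Notation A := (chr G).
Local Notation C := (@conf R d G u).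
Local Notation Y := (@ups R d u).
Local Notation U := (@ups_up R d G u).

Definition hess (f : E -> R) x : Mat := \matrix_(a, b)
  ('D_('e_a) (fun y => 'D_('e_b) f y) x - \sum_c A a x b c * 'D_('e_c) f x).

Definition grad (f : E -> R) c y : R := \sum_e invmx (G y) c e * 'D_('e_e) f y.

(** The divergence of the gradient. *)
Definition laplacian (f : E -> R) x : R :=
  \sum_c 'D_('e_c) (grad f c) x + \sum_e grad f e x * (\sum_c A c x e c).

Definition gradsq (f : E -> R) x : R := \sum_c grad f c x * 'D_('e_c) f x.

Let dY a x : V x -> differentiable (Y a) x.
Proof. by move=> Vx; exact: Csmooth_differentiable (Csmooth_ups mG su u0 a) Vx. Qed.

Let dU a x : V x -> differentiable (U a) x.
Proof. by move=> Vx; exact: Csmooth_differentiable (Csmooth_ups_up mG su u0 a) Vx. Qed.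

Let dG x : V x -> mdiff G x. Proof. by move=> Vx; exact: (metric_mdiff mG Vx). Qed.

Lemma derive_fMr (f : E -> R) x v (k : R) : differentiable f x ->
  'D_v (fun y => f y * k) x = 'D_v f x * k.
Proof.
move=> df; have dk : differentiable (cst k : E -> R) x by exact: differentiable_cst.
by rewrite (derive_fM v df dk) derive_cst mulr0 addr0.
Qed.

Lemma dmx_conf g a x b c : V x -> dmx g (C a) x b c =
  'D_('e_g) (Y a) x * (b == c)%:R + 'D_('e_g) (Y b) x * (a == c)%:R
  - (dmx g G x a b * U c x + G x a b * 'D_('e_g) (U c) x).
Proof.
move=> Vx; rewrite dmxE.
have -> : (fun y => C a y b c) = (fun y =>
    Y a y * (b == c)%:R + Y b y * (a == c)%:R - G y a b * U c y).
  by apply: funext => y; rewrite confE.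
have d1 e (k : R) : differentiable (fun y => Y e y * k) x.
  by apply: differentiableM; [exact: dY|exact: (@differentiable_cst _ _ _ k x)].
have d2 : differentiable (fun y => G y a b * U c y) x.
  by apply: differentiableM; [exact: dG|exact: dU].
rewrite derive_fB//; last exact: differentiableD.
rewrite derive_fD// derive_fMr; last exact: dY.
rewrite derive_fMr; last exact: dY.
by rewrite derive_fM; [rewrite dmxE|exact: dG|exact: dU].
Qed.

Lemma derive_ups a b x : V x -> 'D_('e_a) (Y b) x =
  - ('D_('e_a) (fun y => 'D_('e_b) u y) x / u x) + Y a x * Y b x.
Proof.
move=> Vx; have du := Csmooth_differentiable su Vx.
have d1 := Csmooth_differentiable (Csmooth_derive b su) Vx.
have d2 := Csmooth_differentiable (CsmoothV oV u0 su) Vx.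
have -> : 'D_('e_a) (Y b) x = - 'D_('e_a) (fun y => 'D_('e_b) u y / u y) x.
  rewrite -deriveN//; apply: diff_derivable; exact: differentiableM.
rewrite derive_fM// derive_fV// ?u0// /ups.
move: ('D_('e_a) _ x) ('D_('e_a) u x) ('D_('e_b) u x) (u0 Vx) => p q r.
by move: (u x) => w w0; field.
Qed.

Lemma derive_ups_sym a b x : V x -> 'D_('e_a) (Y b) x = 'D_('e_b) (Y a) x.
Proof.
move=> Vx; rewrite (derive_ups a b Vx) (derive_ups b a Vx).
by rewrite (derive_comm a b oV su Vx); congr (_ + _); exact: mulrC.
Qed.

Lemma hess_ups a b x : V x -> hess u x a b =
  'D_('e_a) (fun y => 'D_('e_b) u y) x + u x * \sum_f A a x b f * Y f x.
Proof.
move=> Vx; rewrite mxE mulr_sumr -sumrN; congr (_ + _); apply: eq_bigr => c _.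
by rewrite /ups !mulrN mulrCA [u x * _]mulrCA mulfV ?u0// mulr1.
Qed.

Lemma derive_ups_up a b x : V x -> 'D_('e_a) (U b) x =
  - ('D_('e_a) (grad u b) x / u x) + grad u b x * 'D_('e_a) u x / u x ^+ 2.
Proof.
move=> Vx; have du := Csmooth_differentiable su Vx.
have d1 : differentiable (grad u b) x.
  apply: differentiable_fsum => e; apply: differentiableM.
    exact: msmooth_mdiff (msmooth_inv mG) Vx _ _.
  exact: Csmooth_differentiable (Csmooth_derive e su) Vx.
have d2 := Csmooth_differentiable (CsmoothV oV u0 su) Vx.
have -> : U b = (fun y => - (grad u b y * (u y)^-1)).
  apply: funext => y; rewrite /ups_up /grad mulr_suml -sumrN.
  by apply: eq_bigr => e _; rewrite /ups mulrN mulrA.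
have -> : 'D_('e_a) (fun y => - (grad u b y * (u y)^-1)) x
    = - 'D_('e_a) (fun y => grad u b y * (u y)^-1) x.
  rewrite -deriveN//; apply: diff_derivable; exact: differentiableM.
rewrite derive_fM// derive_fV// ?u0//.
move: ('D_('e_a) (grad u b) x) (grad u b x) ('D_('e_a) u x) (u0 Vx) => p q r.
by move: (u x) => w w0; field.
Qed.

Definition ric_conf_coef x : R :=
  (u x)^-1 * laplacian u x - (d%:R - 1) * (u x) ^- 2 * gradsq u x.

Lemma ups_upE c x : U c x = - (grad u c x / u x).
Proof.
rewrite /ups_up /grad mulr_suml -sumrN.
by apply: eq_bigr => e _; rewrite /ups mulrN mulrA.
Qed.

(** With [Upsilon = - du / u] the terms quadratic in Upsilon combine with the
    derivative of Upsilon into the Hessian of [u] divided by [u]. *)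
Lemma ric_conf x : V x -> ric (chr H) x =
  ric A x + ((d%:R - 2) / u x) *: hess u x + ric_conf_coef x *: G x.
Proof.
move=> Vx; apply/matrixP => a b.
have chrHE e y : V y -> chr H e y = A e y + C e y.
  exact: chr_conf mG su u0 HE _ _.
have dA e : mdiff (A e) x := chr_mdiff mG e Vx.
have dC e : mdiff (C e) x.
  by exact: msmooth_mdiff (msmooth_conf mG su u0 e) Vx.
have dH e f : dmx e (chr H f) x = dmx e (A f) x + dmx e (C f) x.
  by rewrite -dmxD//; apply: dmx_near oV Vx _ => y Vy; rewrite chrHE.
have curvHE c : curv (chr H) c a x b c = curv A c a x b c
    + dmx c (C a) x b c - dmx a (C c) x b c
    + (C a x *m A c x + A a x *m C c x - C c x *m A a x - A c x *m C a x
          + C a x *m C c x - C c x *m C a x) b c.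
  have -> : curv (chr H) c a x = curv A c a x + dmx c (C a) x - dmx a (C c) x
    + (C a x *m A c x + A a x *m C c x - C c x *m A a x - A c x *m C a x
          + C a x *m C c x - C c x *m C a x).
    rewrite /curv (dH c a) (dH a c) !chrHE//.
    move: (dmx c (A a) x) (dmx a (A c) x) (dmx c (C a) x) (dmx a (C c) x).
    by move: (A c x) (A a x) (C c x) (C a x) => *; mxring.
  rewrite [LHS]addmxE [X in X + _ = _]addmxE oppmxE.
  by rewrite [X in X - _ + _ = _]addmxE.
rewrite !addmxE [X in _ + X + _]mxE [X in _ + X]mxE ricE [in RHS]ricE.
under eq_bigr do rewrite curvHE.
rewrite !big_split sumrN /=.
rewrite (@ric_conf_algebra _ _ (fun e => Y e x) (fun e => U e x) (G x)
   (fun e => A e x) (fun e => C e x)); first last.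
- by move=> *; exact: confE.
- by move=> *; exact: (chr_sym mG).
- exact: GT.
- by move=> e; exact: (ups_lower mG).
have S1 : \sum_c dmx c (C a) x b c = 'D_('e_b) (Y a) x + 'D_('e_a) (Y b) x
   - \sum_c dmx c G x a b * U c x - G x a b * \sum_c 'D_('e_c) (U c) x.
  rewrite (eq_bigr _ (fun c _ => dmx_conf c a b c Vx)).
  exact: (conf_deriv_contr (U^~ x) (fun c e => 'D_('e_c) (Y e) x)
    (fun c e => 'D_('e_c) (U e) x) (G x) (fun c => dmx c G x) a b).
have S2 : \sum_c dmx a (C c) x b c = d%:R * 'D_('e_a) (Y b) x.
  under eq_bigr do rewrite dmxE.
  rewrite -derive_fsum => [|c]; last exact: dC.
  transitivity ('D_('e_a) (fun y => Y b y * d%:R) x).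
    apply: derive_near oV Vx _ => y Vy; rewrite mulrC.
    apply: (@conf_trace _ _ (fun e => Y e y) (fun e => U e y) (G y)).
    - by move=> e; exact: (ups_lower mG).
    - exact: GT.
    - by move=> *; exact: confE.
  by rewrite derive_fMr; [rewrite mulrC|exact: dY].
have S3 : \sum_f U f x * (A f x *m G x + (A f x *m G x)^T) a b =
    \sum_c dmx c G x a b * U c x.
  apply: eq_bigr => c _; rewrite (chr_compat mG)// mulrC trmx_mul GT//.
rewrite S1 S2 S3.
rewrite (derive_ups_sym b a Vx) (derive_ups a b Vx) (hess_ups a b Vx).
have -> : ric_conf_coef x = - (\sum_c 'D_('e_c) (U c) x
    + \sum_f U f x * (\sum_c A c x f c) + (d%:R - 2) * \sum_f U f x * Y f x).
  have -> : \sum_c 'D_('e_c) (U c) x =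
      - (\sum_c 'D_('e_c) (grad u c) x / u x) + gradsq u x / u x ^+ 2.
    rewrite /gradsq mulr_suml -sumrN -big_split; apply: eq_bigr => c _ /=.
    exact: derive_ups_up.
  have -> : \sum_f U f x * (\sum_c A c x f c) =
      - (\sum_f grad u f x * (\sum_c A c x f c)) / u x.
    rewrite mulNr mulr_suml -sumrN; apply: eq_bigr => f _ /=.
    by rewrite ups_upE mulNr mulrAC.
  have -> : \sum_f U f x * Y f x = gradsq u x / u x ^+ 2.
    rewrite /gradsq mulr_suml; apply: eq_bigr => f _ /=.
    by rewrite ups_upE /ups mulrNN expr2 invfM mulrACA mulrA.
  by rewrite /ric_conf_coef /laplacian -mulr_suml; exact: ric_conf_coef_arith (u0 Vx).
exact: ric_conf_arith (u0 Vx).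
Qed.

End ConformalRicci.
Arguments hess {R d} G f x.
Arguments grad {R d} G f c y.
Arguments laplacian {R d} G f x.
Arguments gradsq {R d} G f x.
Arguments ric_conf_coef {R d} G u x.

(** * Conformal change of the scalar curvature and of the divergence *)

Lemma div_conf_algebra (R : comPzRingType) d (k s : R) (t dt A C : 'M[R]_d) :
  k *: (s *: t + dt) + (k *: t) *m (A + C) - (A + C) *m (k *: t) =
  k *: (dt + t *m A - A *m t + (s *: t + t *m C - C *m t)).
Proof.
rewrite -scalemxAl -scalemxAr -scalerDr -scalerBr; congr (_ *: _).
by move: (s *: t) => r; mxring.
Qed.

Section ScalarExtension.
Context {R : realType} {d : nat}.
Implicit Types (V : set 'rV[R]_d) (x y : 'rV[R]_d) (a b c e f : 'I_d).
Local Notation E := 'rV[R]_d.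
Local Notation Mat := 'M[R]_d.
Context {V : set E} {G : E -> Mat} {u : E -> R}.
Context (mG : semi_riemannian V G) (su : Csmooth V u).
Let oV : open V. Proof. by case: mG. Qed.

(** The Ricci scalar of [u^-2 G], multiplied out so that no power of [u] is in
    the denominator: it is smooth where [u] vanishes. *)
Definition scal_ext (G : E -> Mat) (u : E -> R) x : R :=
  u x ^+ 2 * scal G x + (d%:R - 2) * u x * \tr (mixed G (hess G u) x)
  + d%:R * (u x * laplacian G u x - (d%:R - 1) * gradsq G u x).

Lemma Csmooth_trace (T : E -> Mat) : msmooth V T -> Csmooth V (fun x => \tr (T x)).
Proof. by move=> sT; apply: Csmooth_sum => // i _; exact: sT. Qed.

Lemma Csmooth_grad c : Csmooth V (grad G u c).
Proof.
apply: Csmooth_sum => // e _; apply: CsmoothM => //.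
  exact: (msmooth_inv mG).
exact: Csmooth_derive.
Qed.

Lemma msmooth_hess : msmooth V (hess G u).
Proof.
move=> a b; have -> : (fun y => hess G u y a b) = (fun y =>
  'D_('e_a) (fun y => 'D_('e_b) u y) y - \sum_c chr G a y b c * 'D_('e_c) u y).
  by apply: funext => y; rewrite mxE.
apply: CsmoothB => //; first by do 2 apply: Csmooth_derive.
apply: Csmooth_sum => // c _; apply: CsmoothM => //; last exact: Csmooth_derive.
exact: (msmooth_chr mG).
Qed.

Lemma Csmooth_scal_ext : Csmooth V (scal_ext G u).
Proof.
have sc k : Csmooth V (fun=> k : R) by exact: Csmooth_cst.
have st T : msmooth V T -> Csmooth V (fun x => \tr (mixed G T x)).
  by move=> sT; apply: Csmooth_trace; exact: msmooth_mixed mG _ sT.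
apply: CsmoothD => //; first apply: CsmoothD => //.
- by apply: CsmoothM => //; [exact: CsmoothX|apply: st; exact: msmooth_chrric mG].
- apply: CsmoothM => //; first by apply: CsmoothM => //; exact: sc.
  by apply: st; exact: msmooth_hess.
apply: CsmoothM => //; apply: CsmoothB => //; apply: CsmoothM => //.
  apply: CsmoothD => //; apply: Csmooth_sum => // c _.
    by apply: Csmooth_derive; exact: Csmooth_grad.
  apply: CsmoothM => //; first exact: Csmooth_grad.
  by apply: Csmooth_sum => // e _; exact: (msmooth_chr mG).
by apply: Csmooth_sum => // c _; apply: CsmoothM => //;
  [exact: Csmooth_grad|exact: Csmooth_derive].
Qed.

Context {H : E -> Mat}.
Context (u0 : forall x, V x -> u x != 0).
Context (HE : forall x, V x -> H x = (u x) ^- 2 *: G x).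
Let GT x : V x -> (G x)^T = G x. Proof. by case: mG => _ _ h _; exact: h. Qed.
Let uG x : V x -> G x \in unitmx. Proof. by case: mG => _ _ _; exact. Qed.

Lemma mixed_conf (T : E -> Mat) x : V x -> mixed H T x = u x ^+ 2 *: mixed G T x.
Proof.
move=> Vx; rewrite /mixed HE// invmxZ; first by rewrite invrK -scalemxAr.
by rewrite unitmxZ ?uG// unitfE invr_eq0 expf_neq0// u0.
Qed.

Lemma scal_conf x : V x -> scal H x = scal_ext G u x.
Proof.
move=> Vx; rewrite /scal mixed_conf//.
have -> : mixed G (ric (chr H)) x = mixed G (ric (chr G)) x
    + ((d%:R - 2) / u x) *: mixed G (hess G u) x + (ric_conf_coef G u x)%:M.
  rewrite /mixed (ric_conf mG su u0 HE Vx) !mulmxDl -!scalemxAl mulmxV ?uG//.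
  by rewrite scalemx1.
rewrite mxtraceZ !mxtraceD mxtraceZ mxtrace_scalar /scal_ext /ric_conf_coef.
rewrite /scal -mulr_natl; move: (\tr _) (\tr _) (laplacian _ _ _) (gradsq _ _ _) => *.
by move: (u0 Vx); move: (u x) => w w0; field.
Qed.

(** Of the change of the connection, contracted with a symmetric trace-free
    tensor [T], only the trace of the difference tensor survives; the weight of
    the inverse metric contributes the rest of the factor [d - 2]. *)
Lemma div_conf (T : E -> Mat) x a : V x -> mdiff T x -> (T x)^T = T x ->
  \tr (mixed G T x) = 0 ->
  mixed_div H (mixed H T) x a = u x ^+ 2 * (mixed_div G (mixed G T) x a)
    - (d%:R - 2) * u x * (\sum_c mixed G T x a c * 'D_('e_c) u x).
Proof.
move=> Vx dT TT trT; have du := Csmooth_differentiable su Vx.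
have dI : mdiff (fun y => invmx (G y)) x by exact: msmooth_mdiff (msmooth_inv mG) Vx.
have dm : mdiff (mixed G T) x by exact: mdiffM.
have Du2 c : 'D_('e_c) (fun y => u y ^+ 2) x = - 2 * ups u c x * u x ^+ 2.
  have -> : (fun y => u y ^+ 2) = (fun y => u y * u y).
    by apply: funext => y; rewrite expr2.
  rewrite derive_fM// /ups; move: ('D_('e_c) u x) (u0 Vx); move: (u x) => w p w0.
  by field.
have dmH c : dmx c (mixed H T) x = u x ^+ 2 *:
    (- (2 * ups u c x) *: mixed G T x + dmx c (mixed G T) x).
  have -> : dmx c (mixed H T) x = dmx c (fun y => u y ^+ 2 *: mixed G T y) x.
    by apply: dmx_near oV Vx _ => y Vy; rewrite mixed_conf.
  apply/matrixP => i j; rewrite dmxE.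
  have -> : (fun y => (u y ^+ 2 *: mixed G T y) i j) =
            (fun y => u y ^+ 2 * mixed G T y i j) by apply: funext => y; rewrite mxE.
  rewrite derive_fM; [|exact: (Csmooth_differentiable (CsmoothX 2 oV su) Vx)|exact: dm].
  rewrite Du2 -dmxE [RHS]mxE addmxE [X in _ * (X + _)]mxE.
  move: (ups _ _) (mixed _ _ _ i j) (dmx _ _ _ i j) (u x ^+ 2) => *; ring.
have gU e : \sum_c G x e c * ups_up G u c x = ups u e x.
  exact: (ups_lower mG).
have CE e b c := @confE _ _ G u e x b c.
have t1 := conf_contr_l CE a (mixed G T x).
have t2 f := conf_trace gU (GT Vx) CE f.
have S1 : \sum_c (mixed G T x *m conf G u c x) a c =
    d%:R * \sum_c mixed G T x a c * ups u c x.
  under eq_bigr do rewrite mxE.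
  rewrite exchange_big mulr_sumr; apply: eq_bigr => f _ /=.
  by rewrite -mulr_sumr t2 mulrCA.
have S2 : \sum_c (conf G u c x *m mixed G T x) a c = 0.
  rewrite t1 trT mulr0 addr0; apply/eqP; rewrite subr_eq0; apply/eqP.
  rewrite /mixed mulmxKV ?uG// /ups_up.
  under [RHS]eq_bigr do rewrite mulr_suml.
  rewrite exchange_big; apply: eq_bigr => e _ /=; rewrite mxE mulr_sumr.
  apply: eq_bigr => f _; rewrite -[in LHS]TT mxE; ring.
transitivity (u x ^+ 2 * (\sum_c (dmx c (mixed G T) x + mixed G T x *m chr G c x
     - chr G c x *m mixed G T x) a c
   + (- (2 * \sum_c mixed G T x a c * ups u c x)
   + \sum_c (mixed G T x *m conf G u c x) a c
   - \sum_c (conf G u c x *m mixed G T x) a c))).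
  rewrite !mulr_sumr -!sumrN -!big_split mulr_sumr; apply: eq_bigr => c _ /=.
  rewrite (chr_conf mG su u0 HE)// mixed_conf// dmH.
  rewrite div_conf_algebra.
  rewrite mxE; congr (_ * _); rewrite addmxE; congr (_ + _).
  rewrite !addmxE [X in X + _ + _]mxE oppmxE; congr (_ + _ - _).
  by rewrite mulNr -mulrA [ups u c x * _]mulrC.
rewrite S1 S2 /mixed_div.
have -> : \sum_c mixed G T x a c * ups u c x =
    - (\sum_c mixed G T x a c * 'D_('e_c) u x) / u x.
  rewrite mulNr mulr_suml -sumrN; apply: eq_bigr => c _.
  by rewrite /ups mulrN mulrA.
move: (\sum_c _) (\sum_c _) (u0 Vx); move: (u x) => w p q w0; by field.
Qed.

End ScalarExtension.

(** * Change of coordinates *)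

Lemma scalemxE (R : pzRingType) p q (k : R) (A : 'M[R]_(p, q)) i j :
  (k *: A) i j = k * A i j.
Proof. by rewrite mxE. Qed.

Section ChangeOfCoordinates.
Context {R : realType} {d : nat}.
Implicit Types (V : set 'rV[R]_d) (x y : 'rV[R]_d) (a b c e f : 'I_d).
Local Notation E := 'rV[R]_d.
Local Notation Mat := 'M[R]_d.
Context {V V' : set E} {G G' : E -> Mat} {phi : E -> E}.
Context (mG : semi_riemannian V G) (mG' : semi_riemannian V' G').
Context (phiV : forall y, V y -> V' (phi y)).
Context (sphi : forall b, Csmooth V (fun y => phi y ord0 b)).
Context {J : E -> Mat}.
Context (JE : forall y a b, V y -> J y a b = 'D_('e_a) (fun z => phi z ord0 b) y).
Context (uJ : forall y, V y -> J y \in unitmx).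
Context (GG' : forall y, V y -> G y = J y *m G' (phi y) *m (J y)^T).
Let oV : open V. Proof. by case: mG. Qed.
Let uG x : V x -> G x \in unitmx. Proof. by case: mG => _ _ _; exact. Qed.

(** The components of [A] along the coordinate directions of the source. *)
Definition pullback (A : 'I_d -> E -> Mat) a y : Mat :=
  \sum_e J y a e *: A e (phi y).

Let dphi y b : V y -> differentiable (fun z => phi z ord0 b) y.
Proof. exact: Csmooth_differentiable. Qed.

Lemma msmooth_jac : msmooth V J.
Proof.
move=> a b.
apply: (@Csmooth_ext _ _ _
  (fun y => 'D_('e_a) (fun z => phi z ord0 b) y)) => //.
  by move=> y Vy; rewrite JE.
exact: Csmooth_derive.
Qed.

Lemma dmx_jacC y a b c : V y -> dmx a J y b c = dmx b J y a c.
Proof.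
move=> Vy; have dJ e f : dmx e J y f c =
    'D_('e_e) (fun z => 'D_('e_f) (fun w => phi w ord0 c) z) y.
  by rewrite dmxE; apply: derive_near oV Vy _ => z Vz; exact: JE.
apply: etrans (dJ a b) (etrans _ (esym (dJ b a))).
exact: derive_comm oV (sphi c) Vy.
Qed.

Lemma derive_comp_phi (F : E -> R) y a : V y -> differentiable F (phi y) ->
  'D_('e_a) (fun z => F (phi z)) y = \sum_e J y a e * 'D_('e_e) F (phi y).
Proof.
move=> Vy dF; have dp b := dphi b Vy; rewrite chain_rule//.
by apply: eq_bigr => e _; rewrite jacobianE// JE.
Qed.

Lemma dmx_comp p q (F : E -> 'M[R]_(p, q)) y a : V y -> mdiff F (phi y) ->
  dmx a (fun z => F (phi z)) y = \sum_e J y a e *: dmx e F (phi y).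
Proof.
move=> Vy dF; apply/matrixP => i j; rewrite dmxE summxE.
rewrite (derive_comp_phi (F := fun z => F z i j))//.
by apply: eq_bigr => e _; rewrite scalemxE dmxE.
Qed.

Lemma mdiff_comp p q (F : E -> 'M[R]_(p, q)) y : V y -> mdiff F (phi y) ->
  mdiff (fun z => F (phi z)) y.
Proof.
move=> Vy dF i j; rewrite -[fun z => _]/((fun w => F w i j) \o phi).
by apply: differentiable_comp => //; apply: differentiable_row => b; exact: dphi.
Qed.

(** The right-hand side, multiplied by the inverse of [J], is a torsion-free
    connection (by symmetry of the second derivatives of [phi]) that preserves
    the metric, so [chr_unique] applies. *)
Lemma chr_pullback y a : V y ->
  chr G a y *m J y = dmx a J y + J y *m pullback (chr G') a y.
Proof.
move=> Vy; have Jy := uJ Vy; have V'y := phiV Vy.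
pose A' e := (dmx e J y + J y *m pullback (chr G') e y) *m invmx (J y).
suff <- : A' a = chr G a y by rewrite mulmxKV.
apply: (chr_unique mG Vy) => [e b c|e].
  rewrite /A' mxE [RHS]mxE; apply: eq_bigr => k _; congr (_ * _).
  rewrite addmxE [RHS]addmxE (dmx_jacC e b k Vy); congr (_ + _).
  rewrite mxE [RHS]mxE; under eq_bigr do rewrite /pullback summxE mulr_sumr.
  rewrite exchange_big; apply: eq_bigr => f _ /=.
  rewrite /pullback summxE mulr_sumr; apply: eq_bigr => h _.
  by rewrite !scalemxE (chr_sym mG')//; ring.
have dJ : mdiff J y by exact: msmooth_mdiff msmooth_jac Vy.
have dG' : mdiff G' (phi y) by exact: (metric_mdiff mG' V'y).
have dG'p := mdiff_comp Vy dG'.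
have -> : dmx e G y = dmx e (fun z => J z *m G' (phi z) *m (J z)^T) y.
  by apply: dmx_near oV Vy _ => z Vz; exact: GG'.
rewrite dmxM; [|exact: mdiffM|exact: mdiff_tr].
rewrite dmxM// dmx_tr dmx_comp//.
have -> : \sum_f J y e f *: dmx f G' (phi y) = pullback (chr G') e y *m G' (phi y)
    + G' (phi y) *m (pullback (chr G') e y)^T.
  rewrite /pullback mulmx_suml linear_sum mulmx_sumr -big_split; apply: eq_bigr => f _ /=.
  by rewrite (chr_compat mG')// scalerDr -scalemxAl linearZ -scalemxAr.
have -> : A' e *m G y =
    (dmx e J y + J y *m pullback (chr G') e y) *m G' (phi y) *m (J y)^T.
  by rewrite /A' GG'// !mulmxA mulmxKV.
have -> : G y *m (A' e)^T =
    J y *m G' (phi y) *m (dmx e J y + J y *m pullback (chr G') e y)^T.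
  rewrite /A' GG'// trmx_mul !mulmxA -[_ *m (J y)^T *m _]mulmxA -trmx_mul mulVmx//.
  by rewrite trmx1 mulmx1.
move: (dmx _ _ _) (pullback _ _ _) (J y) (G' _) => p q r s; mxring.
Qed.

Lemma mdiff_pullback (A : 'I_d -> E -> Mat) y a : V y ->
  (forall e, mdiff (A e) (phi y)) -> mdiff (pullback A a) y.
Proof.
move=> Vy dA i j.
have -> : (fun z => pullback A a z i j) = (fun z => \sum_e J z a e * A e (phi z) i j).
  by apply: funext => z; rewrite summxE; apply: eq_bigr => e _; rewrite scalemxE.
apply: differentiable_fsum => e; apply: differentiableM.
  exact: msmooth_mdiff msmooth_jac Vy _ _.
exact: mdiff_comp Vy (dA e) i j.
Qed.

Lemma dmx_pullback (A : 'I_d -> E -> Mat) y a b : V y ->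
  (forall e, mdiff (A e) (phi y)) -> dmx a (pullback A b) y =
  \sum_f dmx a J y b f *: A f (phi y)
  + \sum_e \sum_f (J y a e * J y b f) *: dmx e (A f) (phi y).
Proof.
move=> Vy dA; have dJ : mdiff J y by exact: msmooth_mdiff msmooth_jac Vy.
apply/matrixP => i j; rewrite dmxE.
have -> : (fun z => pullback A b z i j) = (fun z => \sum_e J z b e * A e (phi z) i j).
  by apply: funext => z; rewrite summxE; apply: eq_bigr => e _; rewrite scalemxE.
rewrite derive_fsum => [|e]; last first.
  by apply: differentiableM; [exact: dJ|exact: mdiff_comp Vy (dA e) i j].
rewrite exchange_big addmxE !summxE -big_split; apply: eq_bigr => f _ /=.
rewrite derive_fM; [|exact: dJ|exact: mdiff_comp Vy (dA f) i j].
rewrite scalemxE -dmxE; congr (_ + _).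
rewrite (derive_comp_phi (F := fun z => A f z i j))//; last exact: dA.
rewrite mulr_sumr summxE; apply: eq_bigr => e _; rewrite scalemxE dmxE; ring.
Qed.

(** The derivatives of [J] disappear by antisymmetry in [a] and [b]. *)
Lemma curv_pullback (A : 'I_d -> E -> Mat) y a b : V y ->
  (forall e, mdiff (A e) (phi y)) -> curv (pullback A) a b y =
  \sum_e \sum_f (J y a e * J y b f) *: curv A e f (phi y).
Proof.
move=> Vy dA; rewrite /curv !dmx_pullback//.
have -> : \sum_f dmx a J y b f *: A f (phi y) = \sum_f dmx b J y a f *: A f (phi y).
  by apply: eq_bigr => f _; rewrite dmx_jacC.
have S2 : \sum_e \sum_f (J y b e * J y a f) *: dmx e (A f) (phi y) =
    \sum_e \sum_f (J y a e * J y b f) *: dmx f (A e) (phi y).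
  rewrite exchange_big; apply: eq_bigr => e _; apply: eq_bigr => f _.
  by rewrite mulrC.
have S3 : pullback A b y *m pullback A a y =
    \sum_e \sum_f (J y a e * J y b f) *: (A f (phi y) *m A e (phi y)).
  rewrite /pullback mulmx_suml exchange_big; apply: eq_bigr => f _ /=.
  rewrite mulmx_sumr; apply: eq_bigr => e _.
  by rewrite -scalemxAl -scalemxAr scalerA mulrC.
have S4 : pullback A a y *m pullback A b y =
    \sum_e \sum_f (J y a e * J y b f) *: (A e (phi y) *m A f (phi y)).
  rewrite /pullback mulmx_suml; apply: eq_bigr => f _ /=.
  rewrite mulmx_sumr; apply: eq_bigr => e _.
  by rewrite -scalemxAl -scalemxAr scalerA.
rewrite S2 S3 S4 opprD addrACA subrr add0r -!sumrN -!big_split /=.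
apply: eq_bigr => e _; rewrite -!sumrN -!big_split; apply: eq_bigr => f _ /=.
by rewrite -!scalerN -!scalerDr.
Qed.

(** The curvature changes by conjugation with [J] and by pullback of its two
    form indices; in the contraction one [J] cancels its inverse. *)
Lemma ric_transform x : V x ->
  ric (chr G) x = J x *m ric (chr G') (phi x) *m (J x)^T.
Proof.
move=> Vx; have Jx := uJ Vx; have V'x := phiV Vx.
have dA' e : mdiff (chr G' e) (phi x) := chr_mdiff mG' e V'x.
have curvJ a b : curv (chr G) a b x *m J x =
    J x *m curv (pullback (chr G')) a b x.
  apply: (gauge_curv a b oV Vx msmooth_jac).
  - by move=> e; exact: (chr_mdiff mG e Vx).
  - by move=> e; exact: mdiff_pullback.
  - by move=> y e Vy; exact: chr_pullback.
have curvE a b : curv (chr G) a b x =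
    \sum_e \sum_f (J x a e * J x b f) *:
      (J x *m curv (chr G') e f (phi x) *m invmx (J x)).
  rewrite -[LHS](mulmxK Jx) curvJ curv_pullback// mulmx_sumr mulmx_suml.
  apply: eq_bigr => e _; rewrite mulmx_sumr mulmx_suml; apply: eq_bigr => f _.
  by rewrite -scalemxAr -scalemxAl.
apply/matrixP => a b; rewrite ricE.
have JJ k e : \sum_c invmx (J x) k c * J x c e = (k == e)%:R.
  by have /matrixP/(_ k e) := mulVmx Jx; rewrite !mxE.
transitivity (\sum_f J x a f * \sum_k (J x *m curv (chr G') k f (phi x)) b k).
  under eq_bigr do rewrite curvE summxE.
  under eq_bigr => c _ do under eq_bigr => e _ do rewrite summxE.
  under eq_bigr => c _ do rewrite exchange_big.
  rewrite exchange_big; apply: eq_bigr => f _ /=.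
  rewrite exchange_big /= mulr_sumr.
  transitivity (\sum_e \sum_k (e == k)%:R *
      (J x a f * (J x *m curv (chr G') e f (phi x)) b k)).
    apply: eq_bigr => e _.
    transitivity (\sum_c \sum_k (J x c e * J x a f) *
      ((J x *m curv (chr G') e f (phi x)) b k * invmx (J x) k c)).
      by apply: eq_bigr => c _; rewrite scalemxE [X in _ * X]mxE mulr_sumr.
    rewrite exchange_big; apply: eq_bigr => k _ /=.
    rewrite eq_sym -JJ mulr_suml; apply: eq_bigr => c _.
    by move: (_ b k) => w; ring.
  apply: eq_bigr => e _.
  exact: (sum_delta_l e (fun k => J x a f * (J x *m curv (chr G') e f (phi x)) b k)).
rewrite mxE.
transitivity (\sum_f \sum_h J x a f * (J x b h * ric (chr G') (phi x) f h)).
  apply: eq_bigr => f _; rewrite -mulr_sumr; congr (_ * _).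
  under eq_bigr do rewrite mxE.
  rewrite exchange_big; apply: eq_bigr => h _ /=.
  by rewrite ricE mulr_sumr.
rewrite exchange_big; apply: eq_bigr => h _ /=.
rewrite mxE mulr_suml; apply: eq_bigr => f _.
by rewrite [_^T _ _]mxE; ring.
Qed.

End ChangeOfCoordinates.

(** * From charts to the manifold *)

Local Notation coord := Defs.coord.

Section InChart.
Context {R : realType} {d : nat} {M : oriented_manifold R d}.
Implicit Types (i j : chart M) (p q : M) (x y : 'rV[R]_d) (W : set M).
Local Notation img i W := (coord i @` (dom i `&` W)).

Definition local_rep (T : tensor2 M) i x : 'M[R]_d := T i (param i x).

Lemma imgP i W x : img i W x ->
  [/\ dom i (param i x), W (param i x) & coord i (param i x) = x].
Proof. by move=> [q [Dq Wq] <-]; rewrite coordK. Qed.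

Lemma img_mem i W p : dom i p -> W p -> img i W (coord i p).
Proof. by move=> Dp Wp; exists p. Qed.

Lemma img_sub i W W' : W `<=` W' -> img i W `<=` img i W'.
Proof. by move=> WW' _ [q [Dq /WW' Wq] <-]; exists q. Qed.

Lemma img_open i W : open W -> open (img i W).
Proof.
move=> oW; have -> : img i W = (coord i @` dom i) `&` [set x | W (param i x)].
  rewrite eqEsubset; split=> [x [q [Dq Wq] <-]|_ [[q Dq <-] /=]].
    by split; [exists q|rewrite /= coordK].
  by rewrite coordK// => Wq; exists q.
rewrite openE => x [Dx Wx].
have nD : nbhs x (coord i @` dom i).
  by apply: open_nbhs_nbhs; split=> //; exact: coord_open.
have nW : nbhs (param i x) W by apply: open_nbhs_nbhs; split.
by apply: filterI => //; exact: (param_continuous Dx nW).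
Qed.

Lemma pd_local i a (f : M -> R) x : (coord i @` dom i) x ->
  pd i a f (param i x) = 'D_('e_a) (f \o param i) x.
Proof. by move=> [q Dq <-]; rewrite /pd !coordK. Qed.

Section LocalExpression.
Context {i : chart M} {W : set M} {g : tensor2 M}.
Context (oW : open W) (mg : semi_riemannian (img i W) (local_rep g i)).
Local Notation V := (img i W).
Local Notation G := (local_rep g i).

Let oV : open V. Proof. exact: img_open. Qed.

Let VD x : V x -> (coord i @` dom i) x.
Proof. by move=> [q [Dq _] <-]; exists q. Qed.

Lemma pd_near a (f : M -> R) (F : 'rV[R]_d -> R) x : V x ->
  (forall y, V y -> f (param i y) = F y) ->
  pd i a f (param i x) = 'D_('e_a) F x.
Proof.
move=> Vx fF; rewrite pd_local; last exact: VD.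
exact: derive_near oV Vx fF.
Qed.

Lemma pd_entry a b c x : V x ->
  pd i a (fun q => g i q b c) (param i x) = dmx a G x b c.
Proof. by move=> Vx; rewrite dmxE; apply: pd_near. Qed.

Lemma christoffelE a b c x : V x ->
  christoffel g i a b c (param i x) = chr G a x b c.
Proof.
move=> Vx; rewrite /christoffel mxE mulr_sumr; apply: eq_bigr => e _.
rewrite loweredE !pd_entry// -[invmx _ e c]/(invmx (G x) e c).
have -> : invmx (g i (param i x)) c e = invmx (G x) e c.
  by rewrite -[in RHS](inv_sym mg Vx) mxE.
by rewrite mulrCA [LHS]mulrC.
Qed.

Lemma riemannE a b c e x : V x ->
  riemann g i a b c e (param i x) = curv (chr G) a b x e c.
Proof.
move=> Vx; rewrite /riemann curvE !dmxE.
rewrite (pd_near a (F := fun y => chr G b y e c))//; last first.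
  by move=> y Vy; exact: christoffelE.
rewrite (pd_near b (F := fun y => chr G a y e c))//; last first.
  by move=> y Vy; exact: christoffelE.
rewrite -[RHS]addrA; congr (_ + _); rewrite mxE [X in _ = _ - X]mxE -sumrB.
apply: eq_bigr => f _; rewrite !christoffelE//.
by congr (_ - _); exact: mulrC.
Qed.

Lemma ricciE x : V x -> ricci g i (param i x) = ric (chr G) x.
Proof.
move=> Vx; apply/matrixP => a b; rewrite mxE ricE.
by apply: eq_bigr => c _; rewrite riemannE.
Qed.

Lemma ricci_scalarE x : V x -> ricci_scalar g i (param i x) = scal G x.
Proof.
move=> Vx; rewrite /ricci_scalar /trace_wrt ricciE// /scal /mixed.
rewrite /mxtrace; apply: eq_bigr => a _; rewrite mxE; apply: eq_bigr => b _.
have -> : invmx (g i (param i x)) a b = invmx (G x) b a.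
  by rewrite -[in RHS](inv_sym mg Vx) mxE.
exact: mulrC.
Qed.

Lemma hessianE (f : M -> R) x : V x ->
  hessian g f i (param i x) = hess G (f \o param i) x.
Proof.
move=> Vx; apply/matrixP => a b; rewrite mxE [RHS]mxE.
rewrite (pd_near a (F := fun y => 'D_('e_b) (f \o param i) y))//; last first.
  by move=> y Vy; apply: pd_local; exact: VD.
congr (_ - _); apply: eq_bigr => c _.
by rewrite christoffelE// pd_local//; exact: VD.
Qed.

Lemma divergence_local (T : tensor2 M) a x : V x -> mdiff (local_rep T i) x ->
  divergence g T i a (param i x) = mixed_div G (mixed G (local_rep T i)) x a.
Proof.
move=> Vx dT; rewrite -(divergenceE mg)//.
apply: eq_bigr => b _; apply: eq_bigr => c _; congr (_ * _).
rewrite /cov_deriv (pd_near c (F := fun y => local_rep T i y a b))//.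
rewrite dmxE; congr (_ - _ - _); apply: eq_bigr => e _; rewrite christoffelE//.
Qed.

End LocalExpression.

Lemma smooth_local (T : tensor2 M) W i : is_tensor2 W T ->
  msmooth (img i W) (local_rep T i).
Proof. by move=> [sT _] a b; exact: sT. Qed.

Lemma lorentzian_unit (g : tensor2 M) i p : lorentzian_metric g -> dom i p ->
  g i p \in unitmx.
Proof.
move=> [_ _ gB] Dp; have [B uB BgB] := gB i p Dp.
have : (Defs.minkowski : 'M[R]_d) \in unitmx.
  rewrite unitmxE unitfE det_diag; apply/prodf_neq0 => k _; rewrite mxE.
  by case: ifP; rewrite ?oppr_eq0 oner_eq0.
by rewrite -BgB !unitmx_mul => /andP[/andP[]].
Qed.

Lemma lorentzian_local (g : tensor2 M) W i : lorentzian_metric g -> open W ->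
  semi_riemannian (img i W) (local_rep g i).
Proof.
move=> lg oW; have [tg sg _] := lg; split.
- exact: img_open.
- exact: msmooth_sub (img_sub (@subsetT _ _)) (smooth_local i tg).
- by move=> x /imgP[Dx _ _]; exact: sg.
- by move=> x /imgP[Dx _ _]; exact: lorentzian_unit.
Qed.

Lemma jac_smooth i j b :
  Csmooth (img i (dom j)) (fun y => (coord j \o param i) y ord0 b).
Proof. exact: transition_smooth. Qed.

Lemma jac_unit i j p : dom i p -> dom j p -> jac i j p \in unitmx.
Proof.
move=> Di Dj; rewrite unitmxE unitfE gt_eqF//.
exact: transition_oriented.
Qed.

Lemma ricci_jac (g : tensor2 M) W i j p : open W ->
  (forall k, semi_riemannian (img k W) (local_rep g k)) ->
  (forall i j q, W q -> dom i q -> dom j q ->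
     g i q = jac i j q *m g j q *m (jac i j q)^T) ->
  W p -> dom i p -> dom j p ->
  ricci g i p = jac i j p *m ricci g j p *m (jac i j p)^T.
Proof.
move=> oW mg gJ Wp Di Dj.
have oV : open (img i (W `&` dom j)).
  by apply: img_open; apply: openI => //; exact: dom_open.
have mgV : semi_riemannian (img i (W `&` dom j)) (local_rep g i).
  by apply: semi_riemannian_sub (mg i) => //; apply: img_sub => q [].
pose phi := coord j \o param i.
have phiV y : img i (W `&` dom j) y -> img j W (phi y).
  by move=> [q [Diq [Wq Djq]] <-]; rewrite /phi /= coordK//; exact: img_mem.
have sphi b : Csmooth (img i (W `&` dom j)) (fun y => phi y ord0 b).
  by apply: Csmooth_sub (jac_smooth i j b); apply: img_sub => q [].
have JE y a b : img i (W `&` dom j) y ->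
    jacobian phi y a b = 'D_('e_a) (fun z => phi z ord0 b) y.
  by move=> Vy; apply: jacobianE => c; exact: Csmooth_differentiable (sphi c) Vy.
have uJ y : img i (W `&` dom j) y -> jacobian phi y \in unitmx.
  by move=> [q [Diq [Wq Djq]] <-]; exact: jac_unit.
have GG y : img i (W `&` dom j) y ->
    local_rep g i y = jacobian phi y *m local_rep g j (phi y) *m (jacobian phi y)^T.
  move=> [q [Diq [Wq Djq]] <-]; rewrite /local_rep /phi /= !coordK//.
  exact: gJ.
have Vx : img i (W `&` dom j) (coord i p) by apply: img_mem.
have := ric_transform mgV (mg j) phiV sphi JE uJ GG Vx.
have -> : ricci g i p = ric (chr (local_rep g i)) (coord i p).
  by rewrite -(ricciE oW (mg i) (img_mem Di Wp)) coordK.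
have -> : ricci g j p = ric (chr (local_rep g j)) (coord j p).
  by rewrite -(ricciE oW (mg j) (img_mem Dj Wp)) coordK.
by rewrite /phi /= coordK.
Qed.

End InChart.

(** * Trace-free parts, and the metric of a scale *)

Section TraceFree.
Context {R : realType} {d : nat}.
Implicit Types (g T S J : 'M[R]_d) (k l : R).

Lemma trace_wrtE g T : trace_wrt g T = \tr (invmx g *m T^T).
Proof.
apply: eq_bigr => a _; rewrite mxE; apply: eq_bigr => b _.
by rewrite [in RHS]mxE.
Qed.

Lemma trace_wrtD g S T : trace_wrt g (S + T) = trace_wrt g S + trace_wrt g T.
Proof. by rewrite !trace_wrtE addmx_tr mulmxDr mxtraceD. Qed.

Lemma trace_wrtZ g k T : trace_wrt g (k *: T) = k * trace_wrt g T.
Proof. by rewrite !trace_wrtE linearZ -scalemxAr mxtraceZ. Qed.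

Lemma trace_wrt_self g : g \in unitmx -> g^T = g -> trace_wrt g g = d%:R.
Proof. by move=> ug gT; rewrite trace_wrtE gT mulVmx// mxtrace1. Qed.

Lemma trace_wrt_scale k g T : k != 0 -> g \in unitmx ->
  trace_wrt (k *: g) T = k^-1 * trace_wrt g T.
Proof.
move=> k0 ug; rewrite !trace_wrtE invmxZ; last by rewrite unitmxZ// unitfE.
by rewrite -scalemxAl mxtraceZ.
Qed.

Lemma tracefree_scale k g T : k != 0 -> g \in unitmx ->
  tracefree_part (k *: g) T = tracefree_part g T.
Proof.
move=> k0 ug; rewrite /tracefree_part trace_wrt_scale// scalerA; congr (_ - _ *: _).
by rewrite -mulrA mulrAC mulVf// mul1r.
Qed.

Lemma tracefree_lin g k l T : (0 < d)%N -> g \in unitmx -> g^T = g ->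
  tracefree_part g (k *: T + l *: g) = k *: tracefree_part g T.
Proof.
move=> d0 ug gT; rewrite /tracefree_part trace_wrtD !trace_wrtZ trace_wrt_self//.
have dn0 : d%:R != 0 :> R by rewrite pnatr_eq0 -lt0n.
rewrite mulrDr [_ * (l * _)]mulrCA mulVf// mulr1.
by apply/matrixP => i j; rewrite !(addmxE, oppmxE, scalemxE); ring.
Qed.

Lemma trace_tracefree g T : (0 < d)%N -> g \in unitmx -> g^T = g ->
  trace_wrt g (tracefree_part g T) = 0.
Proof.
move=> d0 ug gT; rewrite /tracefree_part -scaleNr trace_wrtD trace_wrtZ trace_wrt_self//.
have dn0 : d%:R != 0 :> R by rewrite pnatr_eq0 -lt0n.
by rewrite mulNr mulrAC mulVf// mul1r subrr.
Qed.

Lemma invmx_congr J g : J \in unitmx -> g \in unitmx ->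
  invmx (J *m g *m J^T) = (invmx J)^T *m invmx g *m invmx J.
Proof.
move=> uJ ug; have uJT : J^T \in unitmx by rewrite unitmx_tr.
have uJg : J *m g *m J^T \in unitmx by rewrite !unitmx_mul uJ ug.
apply: (can_inj (mulKmx uJg)); rewrite mulmxV//.
rewrite trmx_inv !mulmxA mulmxK// mulmxK// mulmxV//.
Qed.

Lemma trace_wrt_congr J g T : J \in unitmx -> g \in unitmx ->
  trace_wrt (J *m g *m J^T) (J *m T *m J^T) = trace_wrt g T.
Proof.
move=> uJ ug; rewrite !trace_wrtE invmx_congr// !trmx_mul trmxK !mulmxA.
rewrite mulmxKV// mxtrace_mulC !mulmxA -trmx_mul mulVmx// trmx1 mul1mx.
by [].
Qed.

Lemma tracefree_congr J g T : J \in unitmx -> g \in unitmx ->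
  tracefree_part (J *m g *m J^T) (J *m T *m J^T) = J *m tracefree_part g T *m J^T.
Proof.
move=> uJ ug; rewrite /tracefree_part trace_wrt_congr//.
by rewrite mulmxBr mulmxBl -scalemxAr -scalemxAl.
Qed.

Lemma tracefree_tr g T : g^T = g -> T^T = T ->
  (tracefree_part g T)^T = tracefree_part g T.
Proof.
by move=> gT TT; rewrite /tracefree_part addmx_tr oppmx_tr [(_ *: _)^T]linearZ /= gT TT.
Qed.

End TraceFree.

Section ConformalManifold.
Context {R : realType} {d : nat} {M : conformal_manifold R d}.
Implicit Types (i j : chart M) (p q : M) (g : tensor2 M) (s : density_fam M).
Local Notation img i W := (coord i @` (dom i `&` W)).

Lemma class_lorentzian g : cclass g -> lorentzian_metric g.
Proof. by have [g0 _ ->] := cclassP M => -[]. Qed.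

Lemma class_base : exists g0 : tensor2 M, cclass g0 /\
  forall g, cclass g -> exists omega, rescaling omega g0 g.
Proof.
have [g0 lg0 cE] := cclassP M; exists g0; rewrite cE; split=> [|g [_]//].
split=> //; exists (fun=> 1); split=> // [i|i p Dp].
  by apply: Csmooth_cst; apply: img_open; exact: openT.
by rewrite expr1n scale1r.
Qed.

(** The values of a density in two metrics of the class differ by a positive
    factor. *)
Lemma zero_setE s g p : density 1 s -> cclass g -> zero_set s p <-> s g p = 0.
Proof.
move=> [_ ds] cg; split=> [|sg]; last by exists g.
have [g0 [cg0 g0P]] := class_base.
have sE h : cclass h -> exists2 k, k != 0 & s h p = k * s g0 p.
  move=> ch; have [om omP] := g0P h ch; exists (om p).
    by case: omP => _ om0 _; rewrite gt_eqF.
  rewrite (ds _ _ _ cg0 ch omP) powRr1//.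
  by case: omP => _ om0 _; exact: ltW.
move=> [h ch]; have [k k0 ->] := sE h ch; have [l l0 ->] := sE g cg.
move=> /eqP; rewrite mulf_eq0 (negbTE k0) /= => /eqP ->.
by rewrite mulr0.
Qed.

Lemma zero_set_open s : density 1 s -> open (~` zero_set s).
Proof.
move=> ds; have [g [cg _]] := class_base.
rewrite openE => p /= nz; have [i Dp] := dom_cover p.
have sm : Csmooth (img i setT) (s g \o param i) by case: ds => sd _; exact: sd.
have oD : open (dom i `&` [set: M]) by rewrite setIT; exact: dom_open.
have cs : {for p, continuous (fun q => (s g \o param i) (coord i q))}.
  apply: (@continuous_comp _ _ _ (coord i) (s g \o param i)).
    exact: Defs.coord_continuous.
  by apply: Csmooth_continuous sm _; exact: img_mem.
have snz : (s g \o param i) (coord i p) != 0.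
  by rewrite /= coordK//; apply/eqP => /(zero_setE p ds cg).
have nD : nbhs p (dom i) by apply: open_nbhs_nbhs; split=> //; exact: dom_open.
have nO : nbhs ((s g \o param i) (coord i p)) [set r : R | r != 0].
  by apply: open_nbhs_nbhs; split=> //; exact: open_neq.
apply: filterS (filterI nD (cs _ nO)) => q [Dq /=]; rewrite coordK// => sq.
by move=> /(zero_setE q ds cg) sq0; rewrite sq0 eqxx in sq.
Qed.

(** If the scale vanished on an open set, then so would its gradient there. *)
Lemma zero_set_dense s (U : set M) p : almost_lorentzian_scale s -> open U -> U p ->
  exists q, U q /\ ~ zero_set s q.
Proof.
move=> [ds [g cg sP]] oU Up; apply: contrapT => nq.
have Uz q : U q -> zero_set s q by move=> Uq; apply: contrapT => zq; apply: nq; exists q.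
have [i Dp] := dom_cover p; have [a] := sP i p (Uz p Up) Dp.
rewrite /pd (@derive_near _ _ _ (cst 0) (img i U)).
- by rewrite derive_cst eqxx.
- exact: img_open.
- exact: img_mem.
- by move=> y /imgP[_ Uy _] /=; apply/(zero_setE _ ds cg); exact: Uz.
Qed.

Context {s : density_fam M} (sl : almost_lorentzian_scale s).
Context {gt : tensor2 M} (gtE : metric_of_scale s gt).
Local Notation W := (~` zero_set s).

Let ds : density 1 s. Proof. by case: sl. Qed.

Let oW : open W. Proof. exact: zero_set_open. Qed.

Lemma scale_smooth g i : cclass g -> Csmooth (img i W) (s g \o param i).
Proof.
move=> cg; apply: Csmooth_sub (img_sub (@subsetT _ _)) _.
by case: ds => sd _; exact: sd.
Qed.

Lemma scale_neq0 g p : cclass g -> W p -> s g p != 0.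
Proof. by move=> cg Wp; apply/eqP => /(zero_setE p ds cg). Qed.

Lemma scale_local_neq0 g i x : cclass g -> img i W x -> (s g \o param i) x != 0.
Proof. by move=> cg /imgP[_ Wx _]; exact: scale_neq0. Qed.

Lemma gtilde_local g i x : cclass g -> img i W x ->
  local_rep gt i x = (s g \o param i) x ^- 2 *: local_rep g i x.
Proof. by move=> cg /imgP[Dx Wx _]; exact: gtE. Qed.

Lemma gtilde_metric i : semi_riemannian (img i W) (local_rep gt i).
Proof.
have [g [cg _]] := class_base.
apply: (semi_riemannian_rescaled (lorentzian_local i (class_lorentzian cg) oW)
  (scale_smooth i cg)).
- by move=> x; exact: scale_local_neq0.
- by move=> x; exact: gtilde_local.
Qed.

Lemma gtilde_jac i j q : W q -> dom i q -> dom j q ->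
  gt i q = jac i j q *m gt j q *m (jac i j q)^T.
Proof.
have [g [cg _]] := class_base => Wq Di Dj.
have [[_ gJ] _ _] := class_lorentzian cg.
by rewrite !(gtE cg)// (gJ i j)// -scalemxAr -scalemxAl.
Qed.

Lemma gtilde_ricci_jac i j p : W p -> dom i p -> dom j p ->
  ricci gt i p = jac i j p *m ricci gt j p *m (jac i j p)^T.
Proof. exact: ricci_jac oW gtilde_metric gtilde_jac. Qed.

Lemma gtilde_unit i p : W p -> dom i p -> gt i p \in unitmx.
Proof.
move=> Wp Dp; have [_ _ _] := gtilde_metric i.
by move=> /(_ _ (img_mem Dp Wp)); rewrite /local_rep coordK.
Qed.

Lemma gtilde_sym i p : W p -> dom i p -> (gt i p)^T = gt i p.
Proof.
move=> Wp Dp; have [_ _ + _] := gtilde_metric i.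
by move=> /(_ _ (img_mem Dp Wp)); rewrite /local_rep coordK.
Qed.

Lemma gtilde_ricci_sym i p : W p -> dom i p -> (ricci gt i p)^T = ricci gt i p.
Proof.
move=> Wp Dp; have Vx := img_mem Dp Wp.
have := ricciE oW (gtilde_metric i) Vx; rewrite coordK// => ->.
by apply/matrixP => a b; rewrite mxE; exact: ric_sym (gtilde_metric i) _ _ _ Vx.
Qed.

Lemma gtilde_scalar_chart i j p : W p -> dom i p -> dom j p ->
  ricci_scalar gt i p = ricci_scalar gt j p.
Proof.
move=> Wp Di Dj; rewrite /ricci_scalar (gtilde_ricci_jac Wp Di Dj) (gtilde_jac Wp Di Dj).
by rewrite trace_wrt_congr//; [exact: jac_unit|exact: gtilde_unit].
Qed.

Definition tf_ricci : tensor2 M := fun i p => tracefree_part (gt i p) (ricci gt i p).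

Lemma tf_ricci_tensor : is_tensor2 W tf_ricci.
Proof.
split=> [i a b|i j p Wp Di Dj]; last first.
  rewrite /tf_ricci (gtilde_ricci_jac Wp Di Dj) (gtilde_jac Wp Di Dj).
  by rewrite tracefree_congr//; [exact: jac_unit|exact: gtilde_unit].
have oV : open (img i W) by exact: img_open.
have mg := gtilde_metric i; have [_ sg _ _] := mg.
apply: (@Csmooth_ext _ _ _ (fun x => ric (chr (local_rep gt i)) x a b
   - (d%:R^-1 * scal (local_rep gt i) x) * local_rep gt i x a b)) => //.
  move=> x Vx; rewrite /tf_ricci /tracefree_part /= addmxE oppmxE scalemxE.
  by rewrite -(ricci_scalarE oW mg Vx) -(ricciE oW mg Vx).
apply: CsmoothB => //; first exact: (msmooth_chrric mg).
apply: CsmoothM => //.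
apply: CsmoothM => //; first exact: Csmooth_cst.
by apply: (Csmooth_trace mg); apply: (msmooth_mixed mg); exact: (msmooth_chrric mg).
Qed.

End ConformalManifold.
Arguments tf_ricci {R d M} gt i p.

(** * The equations of a half-Einstein scale in terms of its metric *)

(** [2^-1] comes from the contracted Bianchi identity, [l] from the divergence of
    the multiple of the metric that is subtracted. *)
Lemma mixed_div_tracefree (R : realType) d (V : set 'rV[R]_d) (G t : 'rV[R]_d -> 'M[R]_d)
    (l : R) x a : semi_riemannian V G -> V x ->
  (forall y, V y -> t y = mixed G (ric (chr G)) y - (l * scal G y)%:M) ->
  mixed_div G t x a = (2^-1 - l) * 'D_('e_a) (scal G) x.
Proof.
move=> mG Vx tE; have [oV _ _ _] := mG.
have sm : msmooth V (mixed G (ric (chr G))).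
  by apply: (msmooth_mixed mG); exact: (msmooth_chrric mG).
have dm : mdiff (mixed G (ric (chr G))) x by exact: msmooth_mdiff sm Vx.
have ssc : Csmooth V (scal G) by exact: (Csmooth_trace mG).
have dsc := Csmooth_differentiable ssc Vx.
have dt c : dmx c t x a c = dmx c (mixed G (ric (chr G))) x a c
     - (a == c)%:R * (l * 'D_('e_c) (scal G) x).
  rewrite dmxE (derive_near (g := fun y => mixed G (ric (chr G)) y a c
      - scal G y * (l * (a == c)%:R)) _ oV Vx); last first.
    move=> y Vy; rewrite tE// addmxE oppmxE; congr (_ - _).
    by rewrite mxE -mulr_natr; ring.
  rewrite derive_fB; [|exact: dm|]; last first.
    by apply: differentiableM => //; exact: (@differentiable_cst _ _ _ (l * _) x).
  by rewrite derive_fMr// dmxE; congr (_ - _); ring.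
have -> : mixed_div G t x a = mixed_div G (mixed G (ric (chr G))) x a
    - l * 'D_('e_a) (scal G) x.
  rewrite -(sum_delta_l a (fun c => l * 'D_('e_c) (scal G) x)) -sumrB.
  apply: eq_bigr => c _; rewrite !addmxE !oppmxE dt tE//.
  rewrite mulmxBl mulmxBr mul_scalar_mx mul_mx_scalar !addmxE !oppmxE.
  move: (dmx c (mixed G (ric (chr G))) x a c) ('D_('e_c) (scal G) x) => p D.
  move: ((mixed G (ric (chr G)) x *m chr G c x) a c) => q.
  move: ((chr G c x *m mixed G (ric (chr G)) x) a c) => r.
  by move: ((_ *: chr G c x) a c) => w; ring.
rewrite (contracted_bianchi mG a Vx); move: (mixed_div _ _ _ _) => q.
by field.
Qed.

Section ScaleMetric.
Context {R : realType} {m : nat} (m_gt0 : (0 < m)%N).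
Local Notation n := (m.*2)%N.
Context {M : conformal_manifold R n.+2}.
Implicit Types (i j : chart M) (p q : M) (g : tensor2 M).
Local Notation img i W := (coord i @` (dom i `&` W)).
Context {s : density_fam M} (sl : almost_lorentzian_scale s).
Context {gt : tensor2 M} (gtE : metric_of_scale s gt).
Local Notation W := (~` zero_set s).

Let ds : density 1 s. Proof. by case: sl. Qed.
Let oW : open W. Proof. exact: zero_set_open. Qed.

Let n0 : n%:R != 0 :> R.
Proof. by rewrite pnatr_eq0 double_eq0 -lt0n. Qed.

Lemma class_metric g i : cclass g -> semi_riemannian (img i W) (local_rep g i).
Proof. by move=> cg; exact: lorentzian_local (class_lorentzian cg) oW. Qed.

Lemma class_unit g i p : cclass g -> dom i p -> g i p \in unitmx.
Proof. by move=> cg; exact: lorentzian_unit (class_lorentzian cg). Qed.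

Lemma class_sym g i p : cclass g -> dom i p -> (g i p)^T = g i p.
Proof. by move=> cg Dp; have [_ sg _] := class_lorentzian cg; exact: sg. Qed.

Lemma ricci_conformal g i p : cclass g -> W p -> dom i p -> exists k : R,
  ricci gt i p = ricci g i p + (n%:R / s g p) *: hessian g (s g) i p + k *: g i p.
Proof.
move=> cg Wp Dp; have Vx := img_mem Dp Wp.
have mG := class_metric i cg; have mH := gtilde_metric sl gtE i.
have := ric_conf mG (scale_smooth sl i cg)
  (fun x => scale_local_neq0 sl cg) (fun x => gtilde_local gtE cg) Vx.
rewrite -(ricciE oW mH Vx) -(ricciE oW mG Vx) -(hessianE oW mG _ Vx) /=.
rewrite /local_rep !coordK//.
have -> : (n.+2%:R - 2 : R) = n%:R by rewrite -(addn2 n) natrD addrK.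
by move=> ->; eexists.
Qed.

(** Replace Ric(g) in the Schouten tensor by means of [ricci_conformal]: the
    Hessians cancel, and Ric(gt) remains up to a multiple of the metric. *)
Lemma tracefree_scale_eq g i p : cclass g -> W p -> dom i p ->
  tracefree_part (g i p) (hessian g (s g) i p + s g p *: schouten g i p)
  = (n%:R^-1 * s g p) *: tf_ricci gt i p.
Proof.
move=> cg Wp Dp; have [k Rk] := ricci_conformal cg Wp Dp.
have u0 := scale_neq0 sl cg Wp.
rewrite /tf_ricci (gtE cg Wp Dp) tracefree_scale ?invr_eq0 ?expf_neq0//; last first.
  exact: class_unit.
set c := (2 * n.+1)%:R^-1 * ricci_scalar g i p.
have -> : hessian g (s g) i p + s g p *: schouten g i p =
    (n%:R^-1 * s g p) *: ricci gt i p - (n%:R^-1 * s g p * (c + k)) *: g i p.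
  rewrite Rk /schouten -/c; apply/matrixP => a b.
  rewrite !(addmxE, oppmxE, scalemxE).
  move: (hessian _ _ _ _ a b) (ricci _ _ _ a b) (g i p a b) => h r w.
  by move: u0 n0; move: (s g p) (n%:R) => u N u0 N0; field; rewrite N0 u0.
by rewrite -scaleNr tracefree_lin//; [exact: class_unit|exact: class_sym].
Qed.

(** [div_conf] identifies the left-hand side with the divergence of [Phi] in the
    metric [gt], up to the factor [- 1 / (n u)]; this divergence is
    [(1/2 - 1/N) = n / (2 N)] times the gradient of the Ricci scalar. *)
Lemma divergence_condition g (Phi : tensor2 M) i p a :
  (forall q, W q -> dom i q -> Phi i q = tf_ricci gt i q) ->
  cclass g -> W p -> dom i p ->
  \sum_b \sum_c invmx (g i p) b c * Phi i p a c * pd i b (s g) p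
    - n%:R^-1 * s g p * divergence g Phi i a p
  = - ((2 * n.+2%:R)^-1 / s g p * 'D_('e_a) (scal (local_rep gt i)) (coord i p)).
Proof.
move=> PhiE cg Wp Dp; have Vx := img_mem Dp Wp.
set x := coord i p in Vx *; have px : param i x = p by rewrite /x coordK.
have mG := class_metric i cg; have mH := gtilde_metric sl gtE i.
have oV : open (img i W) by exact: img_open.
have TE y : img i W y -> local_rep Phi i y = local_rep (tf_ricci gt) i y.
  by move=> /imgP[Dy Wy _]; exact: PhiE.
have sT : msmooth (img i W) (local_rep Phi i).
  move=> b c.
  apply: (@Csmooth_ext _ _ _ (fun y => local_rep (tf_ricci gt) i y b c)) => //.
    by move=> y /TE ->.
  by have [st _] := tf_ricci_tensor sl gtE; exact: st.
have dT : mdiff (local_rep Phi i) x by exact: msmooth_mdiff sT Vx.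
have Tx : local_rep Phi i x = tf_ricci gt i p by rewrite TE// /local_rep px.
have u0 := scale_neq0 sl cg Wp.
have TT : (local_rep Phi i x)^T = local_rep Phi i x.
  rewrite Tx tracefree_tr//; first exact: (gtilde_sym sl gtE).
  exact: (gtilde_ricci_sym sl gtE).
have trT : \tr (mixed (local_rep g i) (local_rep Phi i) x) = 0.
  rewrite /mixed mxtrace_mulC -TT -trace_wrtE Tx /local_rep px.
  rewrite /tf_ricci (gtE cg Wp Dp) tracefree_scale ?invr_eq0 ?expf_neq0//; last first.
    exact: class_unit.
  by rewrite trace_tracefree//; [exact: class_unit|exact: class_sym].
have tfE y : img i W y -> mixed (local_rep gt i) (local_rep Phi i) y =
    mixed (local_rep gt i) (ric (chr (local_rep gt i))) y
    - (n.+2%:R^-1 * scal (local_rep gt i) y)%:M.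
  move=> Vy; rewrite /mixed TE// {1}/local_rep /tf_ricci /tracefree_part.
  have -> : trace_wrt (gt i (param i y)) (ricci gt i (param i y)) =
      scal (local_rep gt i) y by exact: (ricci_scalarE oW mH Vy).
  have [_ _ _ uH] := mH.
  by rewrite (ricciE oW mH Vy) mulmxBl -scalemxAl mulmxV ?uH// scalemx1.
have := div_conf mG (scale_smooth sl i cg) (fun x => scale_local_neq0 sl cg)
  (fun x => gtilde_local gtE cg) a Vx dT TT trT.
rewrite (mixed_div_tracefree a mH Vx tfE).
have := divergence_local oW mG a Vx dT; rewrite px => <-.
have -> : \sum_b \sum_c invmx (g i p) b c * Phi i p a c * pd i b (s g) p =
    \sum_c mixed (local_rep g i) (local_rep Phi i) x a c * 'D_('e_c) (s g \o param i) x.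
  apply: eq_bigr => b _; rewrite mxE mulr_suml; apply: eq_bigr => c _.
  rewrite -[pd i b (s g) p]/('D_('e_b) (s g \o param i) x); congr (_ * _).
  rewrite mulrC /local_rep px; congr (_ * _).
  by have := inv_sym mG Vx; rewrite /local_rep px => /matrixP/(_ b c); rewrite mxE => ->.
have -> : (n.+2%:R - 2 : R) = n%:R by rewrite -(addn2 n) natrD addrK.
rewrite /= px.
move: (\sum_c _) (divergence _ _ _ _ _) ('D_('e_a) _ x) u0 => S dv D.
move: (s g p) => u u0 E.
have N2 : n.+2%:R = n%:R + 2 :> R by rewrite -(addn2 n) natrD.
have N20 : n%:R + 2 != 0 :> R by rewrite -N2 pnatr_eq0.
have -> : dv = ((2^-1 - n.+2%:R^-1) * D + n%:R * u * S) / u ^+ 2.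
  by rewrite E; field.
by rewrite N2; field; rewrite u0 n0 N20.
Qed.

End ScaleMetric.

(** * Local constancy of the Ricci scalar across the zero set *)

Section Constancy.
Context {R : realType} {d : nat} {M : conformal_manifold R d}.
Implicit Types (i j : chart M) (p q : M) (g : tensor2 M).
Local Notation img i W := (coord i @` (dom i `&` W)).
Context {s : density_fam M} (sl : almost_lorentzian_scale s).
Context {gt : tensor2 M} (gtE : metric_of_scale s gt).
Local Notation W := (~` zero_set s).

Let ds : density 1 s. Proof. by case: sl. Qed.
Let oW : open W. Proof. exact: zero_set_open. Qed.

Lemma coord_preimage_open i (B : set 'rV[R]_d) : open B ->
  open (dom i `&` [set q | B (coord i q)]).
Proof.
move=> oB; rewrite openE => q [Dq Bq].
have nD : nbhs q (dom i) by apply: open_nbhs_nbhs; split=> //; exact: dom_open.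
have nB : nbhs (coord i q) B by apply: open_nbhs_nbhs; split.
by apply: filterI => //; exact: (Defs.coord_continuous Dq nB).
Qed.

(** Near a point of the zero set, the Ricci scalar is the restriction of the
    smooth function [scal_ext], whose gradient vanishes on a dense set and hence
    on a whole ball. *)
Lemma scalar_locally_constant :
  (forall i p a, W p -> dom i p ->
     'D_('e_a) (scal (local_rep gt i)) (coord i p) = 0) ->
  forall p, exists U : set M, [/\ open U, U p & exists c : R,
    forall q i, U q -> W q -> dom i q -> ricci_scalar gt i q = c].
Proof.
move=> D0 p; have [i Dp] := dom_cover p; have [g [cg _]] := @class_base _ _ M.
have oD : open (img i setT) by apply: img_open; exact: openT.
have mG : semi_riemannian (img i setT) (local_rep g i).
  by apply: lorentzian_local (class_lorentzian cg) _; exact: openT.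
have su : Csmooth (img i setT) (s g \o param i) by case: ds => sd _; exact: sd.
pose F := scal_ext (local_rep g i) (s g \o param i).
have sF : Csmooth (img i setT) F by exact: Csmooth_scal_ext mG su.
have FE x : img i W x -> scal (local_rep gt i) x = F x.
  move=> Vx; exact: (scal_conf (lorentzian_local i (class_lorentzian cg) oW)
    (scale_smooth sl i cg) (fun y => scale_local_neq0 sl cg)
    (fun y => gtilde_local gtE cg) Vx).
(* A nonzero derivative would be nonzero on an open set, which contains points
   off the zero set. *)
have DF a x : img i setT x -> 'D_('e_a) F x = 0.
  move=> Dx; apply/eqP; apply: contraT => nz.
  have cD : {for x, continuous (fun y => 'D_('e_a) F y)}.
    by apply: Csmooth_continuous Dx; exact: Csmooth_derive.
  have nO : nbhs ('D_('e_a) F x) [set r : R | r != 0].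
    by apply: open_nbhs_nbhs; split=> //; exact: open_neq.
  have [B [oB Bx] Bnz] : exists2 B : set 'rV[R]_d, open B /\ B x &
      forall y, B y -> 'D_('e_a) F y != 0.
    have := cD _ nO; rewrite nbhsE => -[B [oB Bx] BS].
    by exists B => // y /BS.
  have [Dpx _ xE] := imgP Dx.
  have [q [[Dq Bq] Wq]] := zero_set_dense sl (coord_preimage_open i oB)
    (conj Dpx (eq_ind_r B Bx xE)).
  have := Bnz _ Bq; rewrite -(derive_near (f := scal (local_rep gt i)) _
    (img_open oW) (img_mem Dq Wq)); last by move=> y; exact: FE.
  by rewrite D0// eqxx.
have Vp : img i setT (coord i p) by exact: img_mem.
have [r r0 rB] : exists2 r : R, 0 < r & ball (coord i p) r `<=` img i setT.
  have : nbhs (coord i p) (img i setT) by apply: open_nbhs_nbhs; split.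
  by move=> /nbhs_ballP[r r0 rB]; exists r.
exists (dom i `&` [set q | ball (coord i p) r (coord i q)]); split.
- by apply: coord_preimage_open; exact: ball_open.
- by split=> //; exact: ballxx.
exists (F (coord i p)) => q j [Diq Bq] Wq Djq.
rewrite (gtilde_scalar_chart sl gtE Wq Djq Diq).
have := ricci_scalarE oW (gtilde_metric sl gtE i) (img_mem Diq Wq).
rewrite coordK// => ->; rewrite FE; last exact: img_mem.
apply: (@gradient0_cst _ _ (coord i p) r F) => //.
- by move=> y /rB; exact: Csmooth_differentiable sF.
- by move=> a y /rB; exact: DF.
- exact: ballxx.
Qed.

(** The points near which the Ricci scalar takes the same value as at [p], off
    the zero set, form a set that is open by definition. It is closed, since the
    constant of a neighbourhood is determined by the values off the zero set,
    which is nowhere dense. *)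
Lemma scalar_constant :
  (forall i p a, W p -> dom i p ->
     'D_('e_a) (scal (local_rep gt i)) (coord i p) = 0) ->
  forall i j p q, W p -> W q -> dom i p -> dom j q ->
    connected_component [set: M] p q ->
    ricci_scalar gt i p = ricci_scalar gt j q.
Proof.
move=> D0 i j p q Wp Wq Dp Dq pq; have lc := scalar_locally_constant D0.
pose A := [set r : M | exists U : set M, [/\ open U, U r &
  forall t k, U t -> W t -> dom k t -> ricci_scalar gt k t = ricci_scalar gt i p]].
have oA : open A.
  rewrite openE => r [U [oU Ur UE]]; apply: filterS (open_nbhs_nbhs (conj oU Ur)).
  by move=> t Ut; exists U.
have cA : closed A.
  rewrite -openC openE => r nAr; have [U [oU Ur [c cE]]] := lc r.
  apply: filterS (open_nbhs_nbhs (conj oU Ur)) => t Ut [U' [oU' Ut' cE']].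
  apply: nAr; exists U; split; [exact: oU|exact: Ur|move=> t' k Ut'' Wt' Dt'].
  have [z [[Uz U'z] Wz]] := zero_set_dense sl (openI oU oU') (conj Ut Ut').
  have [l Dz] := dom_cover z.
  apply: etrans (cE _ _ Ut'' Wt' Dt') (etrans (esym (cE _ _ Uz Wz Dz)) _).
  exact: cE' U'z Wz Dz.
have Ap : A p.
  have [U [oU Up [c cE]]] := lc p.
  exists U; split; [exact: oU|exact: Up|move=> t k Ut Wt Dt].
  exact: etrans (cE _ _ Ut Wt Dt) (esym (cE _ _ Up Wp Dp)).
have cc : connected (connected_component [set: M] p) by exact: component_connected.
have E : connected_component [set: M] p `&` A = connected_component [set: M] p.
  apply: cc; [|by exists A|by exists A].
  by exists p; split=> //; exact: connected_component_refl.
have : connected_component [set: M] p q by [].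
by rewrite -E => -[_ [U [_ Uq UE]]]; exact: esym (UE _ _ Uq Wq Dq).
Qed.

(** Nearby points are joined by segments in a chart, so that they lie in one
    connected component. *)
Lemma scalar_derive0 :
  (forall i j p q, W p -> W q -> dom i p -> dom j q ->
    connected_component [set: M] p q ->
    ricci_scalar gt i p = ricci_scalar gt j q) ->
  forall i p a, W p -> dom i p ->
     'D_('e_a) (scal (local_rep gt i)) (coord i p) = 0.
Proof.
move=> cst_sc i p a Wp Dp; have Vx := img_mem Dp Wp.
have oV : open (img i W) by exact: img_open.
have [r r0 rB] : exists2 r : R, 0 < r & ball (coord i p) r `<=` img i W.
  have : nbhs (coord i p) (img i W) by apply: open_nbhs_nbhs; split.
  by move=> /nbhs_ballP[r r0 rB]; exists r.
have Bx : ball (coord i p) r (coord i p) by exact: ballxx.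
have oB : open (ball (coord i p) r) by exact: ball_open.
rewrite (derive_near (g := cst (ricci_scalar gt i p)) _ oB Bx).
  by rewrite derive_cst.
move=> y By; have Vy := rB _ By; have [Dy Wy _] := imgP Vy.
rewrite -(ricci_scalarE oW (gtilde_metric sl gtE i) Vy); apply: cst_sc => //.
pose path (t : R) : M := param i (coord i p + t *: (y - coord i p)).
have cpath t : t \in `[0, 1] -> {for t, continuous path}.
  rewrite in_itv /= => t01; have := rB _ (ball_convex Bx By t01).
  move=> [z [Dz _] zE].
  apply: (@continuous_comp _ _ _
    (fun t : R => coord i p + t *: (y - coord i p)) (param i)).
    by apply: continuousD; [exact: cst_continuous|exact: scalel_continuous].
  by apply: param_continuous; exists z.
have cconn : connected (path @` `[0, 1]).
  apply: connected_continuous_connected; first exact: segment_connected.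
  by apply: continuous_in_subspaceT => t; rewrite inE /= => t01; exact: cpath.
apply: (@connected_component_max _ _ (path @` `[0, 1])) => //.
- exists 1; first by rewrite /= in_itv /= lexx ler01.
  by rewrite /path scale1r addrCA subrr addr0.
- exists 0; first by rewrite /= in_itv /= lexx ler01.
  by rewrite /path scale0r addr0 coordK.
Qed.

End Constancy.

(** * Half-Einstein scales and half-Einstein metrics *)

Lemma evalCD (R : realType) d (S T : 'M[R]_d) v :
  evalC (S + T) v v = evalC S v v + evalC T v v.
Proof. by rewrite /evalC /realC map_mxD mulmxDr mulmxDl mxE. Qed.

Lemma evalCZ (R : realType) d k (T : 'M[R]_d) v :
  evalC (k *: T) v v = realC k * evalC T v v.
Proof. by rewrite /evalC /realC map_mxZ -scalemxAr -scalemxAl mxE. Qed.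

Section HalfEinsteinScales.
Context {R : realType} {m : nat} (m_gt0 : (0 < m)%N).
Local Notation n := (m.*2)%N.
Context {M : conformal_manifold R n.+2}.
Context {N : chart M -> M -> 'M[R[i]]_(m.+1, n.+2)} {K : chart M -> M -> 'M[R]_(1, n.+2)}.
Context (robinson : almost_robinson N K).
Context {s : density_fam M} (sl : almost_lorentzian_scale s).
Context {gt : tensor2 M} (gtE : metric_of_scale s gt).
Local Notation W := (~` zero_set s).

Lemma evalC_null g i p v : cclass g -> dom i p -> (v <= N i p)%MS ->
  evalC (g i p) v v = 0.
Proof.
move=> cg Dp /submxP[w ->]; have [_ /(_ g i p cg Dp) Ng _ _ _] := robinson.
rewrite /evalC trmx_mul mulmxA -[w *m _ *m _]mulmxA -[w *m _ *m _]mulmxA Ng.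
by rewrite mulmx0 mul0mx mxE.
Qed.

(** The two tensors differ by a multiple of the metric, which vanishes on the
    totally null distribution. *)
Lemma evalC_tf_ricci v i p : section_of N W v -> W p -> dom i p ->
  evalC (tf_ricci gt i p) (v i p) (v i p) = evalC (ricci gt i p) (v i p) (v i p).
Proof.
move=> [_ vN] Wp Dp; have [g [cg _]] := @class_base _ _ M.
rewrite /tf_ricci /tracefree_part -scaleNr evalCD (gtE cg Wp Dp) scalerA evalCZ.
by rewrite (evalC_null cg Dp (vN i p Wp Dp)) mulr0 addr0.
Qed.

(** The equation of a scale determines its tensor, because [u] and [n] do not
    vanish. *)
Lemma half_einstein_tensorE Phi i p : half_einstein_tensor N s Phi ->
  W p -> dom i p -> Phi i p = tf_ricci gt i p.
Proof.
move=> [_ _ _ _ PhiE] Wp Dp; have [g [cg _]] := @class_base _ _ M.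
have := PhiE g i p cg Wp Dp; rewrite (tracefree_scale_eq m_gt0 sl gtE cg Wp Dp).
move=> /esym; apply: scalerI; rewrite mulf_neq0 ?(scale_neq0 sl cg Wp)//.
by rewrite invr_eq0 pnatr_eq0 double_eq0 -lt0n.
Qed.

Lemma tf_ricci_half_einstein : weakly_half_einstein N W gt ->
  half_einstein_tensor N s (tf_ricci gt).
Proof.
move=> whe; split.
- exact: (tf_ricci_tensor sl gtE).
- move=> i p Wp Dp; apply: tracefree_tr; first exact: (gtilde_sym sl gtE Wp Dp).
  exact: (gtilde_ricci_sym sl gtE Wp Dp).
- move=> g i p cg Wp Dp; rewrite /tf_ricci (gtE cg Wp Dp) tracefree_scale.
  + by rewrite trace_tracefree//; [exact: class_unit|exact: class_sym].
  + by rewrite invr_eq0 expf_neq0// (scale_neq0 sl cg Wp).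
  + exact: class_unit.
- by move=> v sv i p Wp Dp; rewrite evalC_tf_ricci//; exact: whe.
- by move=> g i p cg Wp Dp; exact: tracefree_scale_eq.
Qed.

Lemma weakly_half_einsteinP :
  (exists Phi, half_einstein_tensor N s Phi) <-> weakly_half_einstein N W gt.
Proof.
split=> [[Phi hPhi] v sv i p Wp Dp|whe]; last first.
  by exists (tf_ricci gt); exact: tf_ricci_half_einstein.
have [_ _ _ Phi0 _] := hPhi.
by rewrite -evalC_tf_ricci// -(half_einstein_tensorE hPhi Wp Dp); exact: Phi0.
Qed.

Lemma half_einsteinP :
  (exists2 Phi, half_einstein_tensor N s Phi &
    forall g i p a, cclass g -> ~ zero_set s p -> dom i p ->
      \sum_b \sum_c invmx (g i p) b c * Phi i p a c * pd i b (s g) p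
      - n%:R^-1 * s g p * divergence g Phi i a p = 0)
  <-> half_einstein N W gt.
Proof.
split=> [[Phi hPhi divPhi]|[whe csc]].
  split; first by apply/weakly_half_einsteinP; exists Phi.
  apply: (scalar_constant sl gtE) => i p a Wp Dp.
  have [g [cg _]] := @class_base _ _ M.
  have := divPhi g i p a cg Wp Dp.
  rewrite (divergence_condition m_gt0 sl gtE a _ cg Wp Dp); last first.
    by move=> q Wq Dq; exact: half_einstein_tensorE.
  move=> /eqP; rewrite oppr_eq0 !mulf_eq0 !invr_eq0 (negbTE (scale_neq0 sl cg Wp)).
  by rewrite -natrM pnatr_eq0 /= => /eqP.
exists (tf_ricci gt); first exact: tf_ricci_half_einstein.
move=> g i p a cg Wp Dp; rewrite (divergence_condition m_gt0 sl gtE a _ cg Wp Dp)//.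
by rewrite (scalar_derive0 sl gtE csc a Wp Dp) mulr0 oppr0.
Qed.

End HalfEinsteinScales.

Theorem proposition3p10 (R : realType) (m : nat) (m_gt0 : (0 < m)%N)
    (M : conformal_manifold R (m.*2).+2)
    (N : chart M -> M -> 'M[R[i]]_(m.+1, (m.*2).+2))
    (K : chart M -> M -> 'M[R]_(1, (m.*2).+2))
    (robinson : almost_robinson N K)
    (sigma : density_fam M) (sigma_scale : almost_lorentzian_scale sigma)
    (gt : tensor2 M) (gt_def : metric_of_scale sigma gt) :
  (almost_weakly_half_einstein_scale N sigma <->
     weakly_half_einstein N (~` zero_set sigma) gt) /\
  (almost_half_einstein_scale N sigma <->
     half_einstein N (~` zero_set sigma) gt).
Proof.
have P1 := weakly_half_einsteinP m_gt0 robinson sigma_scale gt_def.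
have P2 := half_einsteinP m_gt0 robinson sigma_scale gt_def.
split; split.
- by move=> [_ /P1].
- by move=> /P1.
- by move=> [_ /P2].
- by move=> /P2.
Qed.
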